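(* Let $0\le n_1\le n$, let $f:\mathbb R^n\to\mathbb R$ be differentiable, strongly convex and submodular, $\bm a\in\mathbb R^n$, $\bm\ell\in\mathbb R_+^{n_1}$, $\bm u\in\mathbb R^{n_1}$ with $\bm\ell\le\bm u$, and let $\pi$ be a compatible permutation of $[2n-n_1]$. Then Algorithm A (described in the context, with $v$ defined there) computes the extreme base $\{v(\mathbf e^{\pi_{[k]}})\}_{k=0}^{2n-n_1}$ with $\mathcal O(n)$ invocations of the subroutine $\mathtt{pivot}$.
   Context: **Problem.** $[m]=\{1,\dots,m\}$, $[t]_+=\max\{t,0\}$, $[t]_-=\max\{-t,0\}$. Submodular on $\mathbb R^n$: $f(\bm y^1)+f(\bm y^2)\ge f(\bm y^1\wedge\bm y^2)+f(\bm y^1\vee\bm y^2)$ for all $\bm y^1,\bm y^2$, with $\wedge,\vee$ the componentwise min/max. For $\bm s\in\{0,1\}^{2n-n_1}$ with $s_{n_1+i}\ge s_{n+i}$ for all $i\in[n-n_1]$, $$v(\bm s)=\min_{\bm x\in\mathbb R^n}\{f(\bm x)-\bm a^\top\bm x:\ \ell_is_i\le x_i\le u_is_i\ (i\in[n_1]),\ [x_{n_1+i}]_-s_{n_1+i}=0,\ [x_{n_1+i}]_+(1-s_{n+i})=0\ (i\in[n-n_1])\}.$$ $\pi_{[k]}=\{\pi_1,\dots,\pi_k\}$ and $\mathbf e^{\alpha}$ is the 0/1 characteristic vector of $\alpha$. $\pi$ is compatible if for each $i\in[n-n_1]$ the element $n_1+i$ appears before $n+i$ in $\pi_1,\dots,\pi_{2n-n_1}$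 (so every $\mathbf e^{\pi_{[k]}}$ satisfies $s_{n_1+i}\ge s_{n+i}$). **State.** The algorithm maintains disjoint index sets $\alpha_0,\underline\alpha,\alpha_+,\overline\alpha\subseteq[n_1]$ and $\beta_-,\beta_\ominus,\beta_0,\beta_\oplus,\beta_+\subseteq[n]\setminus[n_1]$, with $\gamma=\alpha_+\cup\beta_-\cup\beta_+$ and $\gamma_0=\alpha_0\cup\beta_0\cup\beta_\ominus\cup\beta_\oplus$ kept up to date. While a driving index $p\in[n]$ is being processed, $p$ lies in none of these sets, and for $y\in\mathbb R$ the associated point $\bm x(y)\in\mathbb R^n$ is given by $x_p=y$, $\bm x_{\gamma_0}=\bm 0$, $\bm x_{\underline\alpha}=\bm\ell_{\underline\alpha}$, $\bm x_{\overline\alpha}=\bm u_{\overline\alpha}$, and $\bm x_\gamma$ the unique solution of $\partial f/\partial x_i(\bm x)=a_i$, $i\in\gamma$ (unique by strong convexity). When no index is being driven the point $\bm x$ is defined in the same way without $x_p$. **Subroutine $\mathtt{pivot}(y_0,\bar y)$** (driving index $p$, current sets). Set $r_i=\infty$ for all $i$. For $i\in\alpha_+$ let $r_i$ be the root (in $y$) of $x_i(y)-u_i=0$; for $i\in\beta_-$ the root of $x_i(y)=0$; for $i\in\underline\alpha\cup\beta_\oplus$ the root of $\frac{\partial f}{\partial x_i}(\bm x(y))-a_i=0$; if an equation has no solution, $r_i=\infty$. Let $i^*$ minimize $r_i$ (ties broken arbitrarily) and $y_{\mathrm{bp}}=\min\{r_{i^*},\bar y\}$. If $y_{\mathrm{bp}}<\bar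 y$, move $i^*$: from $\alpha_+$ to $\overline\alpha$, or from $\beta_-$ to $\beta_\ominus$, or from $\underline\alpha$ to $\alpha_+$, or from $\beta_\oplus$ to $\beta_+$, according to the set containing it. Return $y_{\mathrm{bp}}$ and the sets. **Algorithm A.** Setup: let $\bm x$ minimize $f(\bm x)-\bm a^\top\bm x$ subject to $x_i=0$ ($i\in[n_1]$), $x_i\le0$ ($i\in[n]\setminus[n_1]$); output $v(\bm 0)=f(\bm x)-\bm a^\top\bm x$; set $\alpha_0=[n_1]$, $\beta_-=\{i:x_i<0\}$, $\beta_\ominus=[n]\setminus(\alpha_0\cup\beta_-)$, all other sets empty. For $k=0,1,\dots,2n-n_1-1$, let $p=\pi_{k+1}$ if $\pi_{k+1}\le n$ and $p=\pi_{k+1}-n+n_1$ otherwise, let $y_0=x_p$, and: (i) If $\pi_{k+1}\le n_1$: remove $p$ from $\alpha_0$. While $y_0<\ell_p$, call $\mathtt{pivot}(y_0,\ell_p)$ and replace $y_0$ and the sets by its output. Then, if $\frac{\partial f}{\partial x_p}(\bm x(\ell_p))-a_p\ge0$, add $p$ to $\underline\alpha$. Otherwise repeat: let $\bar y$ be the root of $\frac{\partial f}{\partial x_p}(\bm x(y))-a_p=0$, set $\bar y\leftarrow\min\{\bar y,u_p\}$, call $\mathtt{pivot}(y_0,\bar y)$ and update $y_0$ and the sets; until $y_0=\bar y$. Then add $p$ to $\alpha_+$ if $\bar y<u_p$ and to $\overline\alpha$ if $\bar y=u_p$. (ii) If $n_1<\pi_{k+1}\le n$: if $y_0=0$, remove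 $p$ from $\beta_\ominus$; otherwise ($y_0<0$) remove $p$ from $\beta_-$ and repeatedly call $\mathtt{pivot}(y_0,0)$, updating $y_0$ and the sets, until $y_0=0$. Then add $p$ to $\beta_0$. (iii) If $n<\pi_{k+1}\le 2n-n_1$: (then $y_0=0$) remove $p$ from $\beta_0$. If $\frac{\partial f}{\partial x_p}(\bm x(0))-a_p\ge0$, add $p$ to $\beta_\oplus$. Otherwise repeat: let $\bar y$ be the root of $\frac{\partial f}{\partial x_p}(\bm x(y))-a_p=0$, call $\mathtt{pivot}(y_0,\bar y)$ and update $y_0$ and the sets; until $y_0=\bar y$. Then add $p$ to $\beta_+$. After the case, let $\bm x$ be the point determined by the current sets and output $v(\mathbf e^{\pi_{[k+1]}})=f(\bm x)-\bm a^\top\bm x$.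
   Formalization: In case (ii) with y_0 = 0, p is removed from whichever set contains it (β_⊖, or β_- after a tie r_p = ȳ) before being added to β_0; removing it from β_⊖ only would leave p in both β_- and β_0 after such a tie and the sets would not be disjoint. *)

(* Defs.v *)
(* MathComp / MathComp-Analysis. *)
From HB Require Import structures.
From mathcomp Require Import all_boot all_order all_fingroup all_algebra.
From mathcomp Require Import all_classical all_reals all_analysis.

Set Implicit Arguments.
Unset Strict Implicit.
Unset Printing Implicit Defensive.

Import Order.TTheory GRing.Theory Num.Theory.
Import numFieldNormedType.Exports.

Local Open Scope ring_scope.

Definition partial (R : realType) (n : nat) (f : 'rV[R]_n -> R) (i : 'I_n)
    (x : 'rV[R]_n) : R :=
  'D_(delta_mx 0 i) f x.

Definition submodular (R : realType) (n : nat) (f : 'rV[R]_n -> R) : Prop :=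
  forall y1 y2 : 'rV[R]_n,
    f (\row_i Num.min (y1 0 i) (y2 0 i)) + f (\row_i Num.max (y1 0 i) (y2 0 i))
    <= f y1 + f y2.

(* The library norm on ['rV_n] is the max norm, hence the explicit sum for the
   squared Euclidean norm. *)
Definition strongly_convex (R : realType) (n : nat) (f : 'rV[R]_n -> R) : Prop :=
  exists2 mu : R, 0 < mu &
    forall (x y : 'rV[R]_n) (t : R), 0 <= t <= 1 ->
      f (t *: x + (1 - t) *: y)
      <= t * f x + (1 - t) * f y
         - mu / 2 * t * (1 - t) * \sum_i (x 0 i - y 0 i) ^+ 2.

(* Every maximal sequence of transitions from [c] is finite and stops in a
   configuration satisfying [Q]; a configuration in which the algorithm is stuck
   (e.g. because a required root does not exist) counts as a stop. *)
Inductive every_run_ends_in (T : Type) (step : T -> T -> Prop) (Q : T -> Prop)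
    (c : T) : Prop :=
| run_halts of (forall c', ~ step c c') & Q c
| run_goes_on of (exists c', step c c') &
    (forall c', step c c' -> every_run_ends_in step Q c').

(* The set of an index; an index carries no label exactly while it is driven.
   In order: alpha_0, underlined alpha, alpha_+, overlined alpha,
   beta_-, beta_(-) (circled minus), beta_0, beta_(+) (circled plus), beta_+. *)
Inductive label :=
| Alpha0 | AlphaLow | AlphaPlus | AlphaUp
| BetaMinus | BetaOminus | Beta0 | BetaOplus | BetaPlus.

(* Here [n1 + n2] is the dimension n, so that n2 = n - n1 and
   2 n - n1 = (n1 + n2) + n2.  The 1-based indices n1 + i and n + i of
   [{1, ..., 2 n - n1}], for i in [{1, ..., n - n1}], are
   [lshift n2 (rshift n1 i)] and [rshift (n1 + n2) i]. *)
Section Algorithm.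
Variables (R : realType) (n1 n2 : nat).
Variables (f : 'rV[R]_(n1 + n2) -> R) (a : 'rV[R]_(n1 + n2)) (l u : 'rV[R]_n1).
Variable pi : {perm 'I_(n1 + n2 + n2)}.

Local Notation point := ('rV[R]_(n1 + n2)).
Local Notation index := ('I_(n1 + n2)).

Definition objective (x : point) : R := f x - \sum_i a 0 i * x 0 i.

Definition feasible (s : 'I_(n1 + n2 + n2) -> bool) (x : point) : Prop :=
  (forall i : 'I_n1,
     let si : R := (s (lshift n2 (lshift n2 i)))%:R in
     l 0 i * si <= x 0 (lshift n2 i) <= u 0 i * si) /\
  (forall i : 'I_n2,
     let xi := x 0 (rshift n1 i) in
     Num.max (- xi) 0 * (s (lshift n2 (rshift n1 i)))%:R = 0 /\
     Num.max xi 0 * (1 - (s (rshift (n1 + n2) i))%:R) = 0).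

(* The minimum v(s) exists and equals [r]. *)
Definition is_value (s : 'I_(n1 + n2 + n2) -> bool) (r : R) : Prop :=
  (exists2 x, feasible s x & r = objective x) /\
  (forall x, feasible s x -> r <= objective x).

Definition compatible : Prop :=
  forall i : 'I_n2,
    ((pi^-1)%g (lshift n2 (rshift n1 i)) < (pi^-1)%g (rshift (n1 + n2) i))%N.

(* Characteristic vector of the first [k] elements of [pi]. *)
Definition char_prefix (k : nat) (j : 'I_(n1 + n2 + n2)) : bool :=
  [exists i : 'I_(n1 + n2 + n2), (i < k)%N && (pi i == j)].

Definition labelling := index -> option label.

Definition set_label (st : labelling) (p : index) (o : option label) :
    labelling :=
  fun i => if i == p then o else st i.

(* The bounds exist only for the first [n1] coordinates, the only ones that ever
   carry an alpha label; in a run the padding by 0 is never read. *)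
Definition pad (b : 'rV[R]_n1) : point := row_mx b 0.

(* [x] is a point associated with the sets; it is unconstrained at an unlabelled
   (driven) index. *)
Definition point_of (st : labelling) (x : point) : Prop :=
  forall i, match st i with
  | None => True
  | Some AlphaLow => x 0 i = pad l 0 i
  | Some AlphaUp => x 0 i = pad u 0 i
  | Some (AlphaPlus | BetaMinus | BetaPlus) => partial f i x = a 0 i
  | Some (Alpha0 | Beta0 | BetaOminus | BetaOplus) => x 0 i = 0
  end.

(* [X] is the curve y |-> x(y) for the driving index [p]. *)
Definition curve_of (st : labelling) (p : index) (X : R -> point) : Prop :=
  forall y, X y 0 p = y /\ point_of st (X y).

Definition root_or_infty (E : R -> Prop) (r : \bar R) : Prop :=
  (exists2 y, E y & r = y%:E) \/ ((forall y, ~ E y) /\ r = +oo%E).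

Definition breakpoint (st : labelling) (X : R -> point) (i : index)
    (r : \bar R) : Prop :=
  match st i with
  | Some AlphaPlus => root_or_infty (fun y => X y 0 i - pad u 0 i = 0) r
  | Some BetaMinus => root_or_infty (fun y => X y 0 i = 0) r
  | Some (AlphaLow | BetaOplus) =>
      root_or_infty (fun y => partial f i (X y) - a 0 i = 0) r
  | _ => r = +oo%E
  end.

Definition moved (o : option label) : option label :=
  match o with
  | Some AlphaPlus => Some AlphaUp
  | Some BetaMinus => Some BetaOminus
  | Some AlphaLow => Some AlphaPlus
  | Some BetaOplus => Some BetaPlus
  | _ => o
  end.

(* A call [pivot(y0, ybar)] may return [ybp] and [st'].  The relation leaves open
   the choice of i* among ties, and of r_i when the equation has several roots;
   [y0], where the drive stands, does not enter the equations. *)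
Definition pivot (st : labelling) (p : index) (y0 ybar ybp : R)
    (st' : labelling) : Prop :=
  exists (X : R -> point) (r : index -> \bar R) (istar : index),
    [/\ curve_of st p X,
        forall i, breakpoint st X i (r i),
        forall i, (r istar <= r i)%E,
        ybp%:E = Order.min (r istar) ybar%:E &
        st' = if ybp < ybar then set_label st istar (moved (st istar)) else st].

(* Control points of one pass of the main loop: [Idle x] before the pass, with
   current point [x]; [Settled] after the case, before the output; the others are
   the heads of the loops of (i) (first the while loop, then the repeat loop),
   (ii) and (iii), with driving index [p] and current [y0]. *)
Inductive phase :=
| Idle of point
| ToLower (p : index) (y0 : R)
| Upward (p : index) (y0 : R)
| ToZero (p : index) (y0 : R)
| Positive (p : index) (y0 : R)
| Settled.

(* [calls] counts the invocations of [pivot]. *)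
Record config := Config {
  iter : nat;
  control : phase;
  sets : labelling;
  outputs : seq R;
  calls : nat }.

Definition initial (c : config) : Prop :=
  exists x : point,
    let feas0 (z : point) :=
      (forall i : 'I_n1, z 0 (lshift n2 i) = 0) /\
      (forall i : 'I_n2, z 0 (rshift n1 i) <= 0) in
    [/\ feas0 x,
        forall z, feas0 z -> objective x <= objective z &
        c = Config 0 (Idle x)
              (fun i => match fintype.split i with
                        | inl _ => Some Alpha0
                        | inr _ => Some (if x 0 i < 0 then BetaMinus
                                         else BetaOminus)
                        end)
              [:: objective x] 0].

Inductive step : config -> config -> Prop :=
(* (i) *)
| start_i k (kN : (k < n1 + n2 + n2)%N) (j : 'I_n1) (x : point) st o m :
    pi (Ordinal kN) = lshift n2 (lshift n2 j) ->
    let p := lshift n2 j in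
    step (Config k (Idle x) st o m)
         (Config k (ToLower p (x 0 p)) (set_label st p None) o m)
| to_lower_pivot k p y0 y st st' o m :
    y0 < pad l 0 p ->
    pivot st p y0 (pad l 0 p) y st' ->
    step (Config k (ToLower p y0) st o m)
         (Config k (ToLower p y) st' o m.+1)
| to_lower_stop k p y0 st (X : R -> point) o m :
    pad l 0 p <= y0 ->
    curve_of st p X ->
    0 <= partial f p (X (pad l 0 p)) - a 0 p ->
    step (Config k (ToLower p y0) st o m)
         (Config k Settled (set_label st p (Some AlphaLow)) o m)
| to_lower_continue k p y0 st (X : R -> point) o m :
    pad l 0 p <= y0 ->
    curve_of st p X ->
    partial f p (X (pad l 0 p)) - a 0 p < 0 ->
    step (Config k (ToLower p y0) st o m)
         (Config k (Upward p y0) st o m)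
| upward_pivot k p y0 y st st' (X : R -> point) yroot o m :
    curve_of st p X ->
    partial f p (X yroot) - a 0 p = 0 ->
    let ybar := Num.min yroot (pad u 0 p) in
    pivot st p y0 ybar y st' ->
    step (Config k (Upward p y0) st o m)
         (if y == ybar
          then Config k Settled
                 (set_label st' p
                    (Some (if ybar < pad u 0 p then AlphaPlus else AlphaUp)))
                 o m.+1
          else Config k (Upward p y) st' o m.+1)
(* (ii); when y0 = 0, [p] is removed from whichever of beta_(-) and beta_-
   contains it: a tie at a breakpoint can leave [p] in beta_- with x_p = 0. *)
| start_ii_zero k (kN : (k < n1 + n2 + n2)%N) (j : 'I_n2) (x : point) st o m :
    pi (Ordinal kN) = lshift n2 (rshift n1 j) ->
    let p := rshift n1 j in
    x 0 p = 0 ->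
    step (Config k (Idle x) st o m)
         (Config k Settled (set_label st p (Some Beta0)) o m)
| start_ii_nonzero k (kN : (k < n1 + n2 + n2)%N) (j : 'I_n2) (x : point) st o m :
    pi (Ordinal kN) = lshift n2 (rshift n1 j) ->
    let p := rshift n1 j in
    x 0 p <> 0 ->
    step (Config k (Idle x) st o m)
         (Config k (ToZero p (x 0 p)) (set_label st p None) o m)
| to_zero_pivot k p y0 y st st' o m :
    pivot st p y0 0 y st' ->
    step (Config k (ToZero p y0) st o m)
         (if y == 0
          then Config k Settled (set_label st' p (Some Beta0)) o m.+1
          else Config k (ToZero p y) st' o m.+1)
(* (iii) *)
| start_iii_stop k (kN : (k < n1 + n2 + n2)%N) (j : 'I_n2)
    (x : point) st (X : R -> point) o m :
    pi (Ordinal kN) = rshift (n1 + n2) j ->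
    let p := rshift n1 j in
    curve_of (set_label st p None) p X ->
    0 <= partial f p (X 0) - a 0 p ->
    step (Config k (Idle x) st o m)
         (Config k Settled (set_label st p (Some BetaOplus)) o m)
| start_iii_continue k (kN : (k < n1 + n2 + n2)%N) (j : 'I_n2)
    (x : point) st (X : R -> point) o m :
    pi (Ordinal kN) = rshift (n1 + n2) j ->
    let p := rshift n1 j in
    curve_of (set_label st p None) p X ->
    partial f p (X 0) - a 0 p < 0 ->
    step (Config k (Idle x) st o m)
         (Config k (Positive p (x 0 p)) (set_label st p None) o m)
| positive_pivot k p y0 y st st' (X : R -> point) ybar o m :
    curve_of st p X ->
    partial f p (X ybar) - a 0 p = 0 ->
    pivot st p y0 ybar y st' ->
    step (Config k (Positive p y0) st o m)
         (if y == ybar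
          then Config k Settled (set_label st' p (Some BetaPlus)) o m.+1
          else Config k (Positive p y) st' o m.+1)
| output k st (x : point) o m :
    point_of st x ->
    step (Config k Settled st o m)
         (Config k.+1 (Idle x) st (rcons o (objective x)) m).

Definition completed (c : config) : Prop :=
  iter c = (n1 + n2 + n2)%N /\ exists x, control c = Idle x.

End Algorithm.

(* Main.v *)
Require Import Defs.
From HB Require Import structures.
From mathcomp Require Import all_boot all_order all_fingroup all_algebra.
From mathcomp Require Import all_classical all_reals all_analysis.
From mathcomp Require Import ring lra zify.
Set Implicit Arguments.
Unset Strict Implicit.
Unset Printing Implicit Defensive.
Import Order.TTheory GRing.Theory Num.Theory.
Import numFieldNormedType.Exports.
Local Open Scope ring_scope.

(* By submodularity the curve x(y) is nondecreasing and the partial derivative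
   at a coordinate held fixed is nonincreasing along it, while strong convexity
   makes the partial derivative at the driving coordinate increasing.  Hence,
   while the drive goes up, the optimality conditions attached to the labels
   persist until a breakpoint, and the label can then be moved forward.  Labels
   only move forward, so every index is moved a bounded number of times, and
   every other call of pivot ends a loop; this gives at most 3n calls.  The
   equations defining the breakpoints may have several roots, so a call may
   bring [y0] backwards; the optimality conditions are therefore maintained at
   the largest value reached so far by the driving coordinate.  Between passes
   they are the first-order conditions characterizing the minimum v(s). *)

(** * Directional derivatives and first-order conditions *)

Section DirectionalDerivatives.
Variables (R : realType) (n : nat) (f : 'rV[R]_n -> R).
Implicit Types (x z v w : 'rV[R]_n).

Lemma derive_remainder x v (eta : R) : differentiable f x -> 0 < eta ->
  exists2 delta : R, 0 < delta & forall t, 0 < t < delta ->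
    `|f (x + t *: v) - f x - t * 'D_v f x| <= eta * t.
Proof.
move=> /(@diff_derivable _ _ _ f x v) df eta0.
have /cvgrPdist_le /(_ _ eta0) := df.
case=> delta /= delta0 D; exists delta => // t /andP[t0 td].
have := D t; rewrite /ball_ /= sub0r normrN (gtr0_norm t0) => /(_ td).
move=> /(_ (lt0r_neq0 t0)) H.
rewrite -[X in X - _](_ : t * (t^-1 * (f (t *: v + x) - f x)) = _); last first.
  by rewrite mulVKf ?gt_eqF// (addrC x).
by rewrite -mulrBr normrM (gtr0_norm t0) mulrC ler_wpM2r ?(ltW t0)// distrC.
Qed.

(** Divide by [t] and let [t] tend to 0 from above: [t * K] leaves the constant [K] and the
    quadratic term disappears. Zero directions are allowed, so convexity and minimality inequalities
    can also be differentiated this way. *)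
Lemma derive_le x z v w (e K M : R) :
  differentiable f x -> differentiable f z -> 0 < e ->
  (forall t, 0 < t <= e ->
     f (z + t *: v) - f z <= f (x + t *: w) - f x + t * (K + t * M)) ->
  'D_v f z <= 'D_w f x + K.
Proof.
move=> dx dz e0 H; rewrite leNgt; apply/negP => lt.
(* A quarter of the supposed gap: two remainders and the term [t * M] each cost at most [eta], and
   three quarters cannot fill the gap. *)
pose eta := ('D_v f z - 'D_w f x - K) / 4.
have eta0 : 0 < eta by rewrite divr_gt0// subr_gt0; lra.
have [d1 d10 D1] := derive_remainder v dz eta0.
have [d2 d20 D2] := derive_remainder w dx eta0.
have M0 : 0 < `|M| + 1 by rewrite ltr_wpDl.
pose t := Num.min (Num.min (d1 / 2) (d2 / 2)) (Num.min e (eta / (`|M| + 1))).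
have t0 : 0 < t.
  by rewrite /t !lt_min e0 (divr_gt0 eta0 M0) (divr_gt0 d10) ?(divr_gt0 d20).
have : t <= t by exact: lexx.
rewrite {2}/t !le_min => /andP[/andP[td1 td2] /andP[te tM]].
have /ler_normlP[_ +] := D2 t ltac:(apply/andP; split; lra).
have /ler_normlP[+ _] := D1 t ltac:(apply/andP; split; lra).
have := H t ltac:(apply/andP; split; lra).
have tM' : t * M <= eta.
  move: tM; rewrite ler_pdivlMr// => tM.
  apply: le_trans tM; rewrite ler_pM2l//.
  by rewrite (le_trans (ler_norm M))// lerDl.
move=> h1 h2 h3.
have : t * 'D_v f z <= t * ('D_w f x + K + 3 * eta).
  have : t * (t * M) <= t * eta by rewrite ler_pM2l.
  lra.
rewrite ler_pM2l// /eta; lra.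
Qed.

Lemma derive_partial x v : differentiable f x ->
  'D_v f x = \sum_i v 0 i * partial f i x.
Proof.
move=> dx; rewrite deriveE// {1}(row_sum_delta v) linear_sum.
by apply: eq_bigr => i _; rewrite linearZ /= /partial deriveE.
Qed.

End DirectionalDerivatives.

(** * Consequences of strong convexity and submodularity *)

Section Optimization.
Variables (R : realType) (n : nat) (f : 'rV[R]_n -> R) (a : 'rV[R]_n) (mu : R).
Hypothesis df : forall x, differentiable f x.
Hypothesis mu0 : 0 < mu.
Hypothesis fconv : forall (x y : 'rV[R]_n) (t : R), 0 <= t <= 1 ->
  f (t *: x + (1 - t) *: y)
  <= t * f x + (1 - t) * f y
     - mu / 2 * t * (1 - t) * \sum_i (x 0 i - y 0 i) ^+ 2.
Hypothesis fsub : submodular f.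
Implicit Types (x z v : 'rV[R]_n).

Local Notation obj x := (f x - \sum_i a 0 i * x 0 i).
Local Notation sqdist x z := (\sum_i (x 0 i - z 0 i) ^+ 2).

Lemma sqdistC x z : sqdist x z = sqdist z x.
Proof. by apply: eq_bigr => i _; rewrite -sqrrN opprB. Qed.

Lemma sqdist_ge0 x z : 0 <= sqdist x z.
Proof. by apply: sumr_ge0 => i _; apply: sqr_ge0. Qed.

Lemma sqdist_coord x z i : (x 0 i - z 0 i) ^+ 2 <= sqdist x z.
Proof.
by rewrite (bigD1 i)//= lerDl; apply: sumr_ge0 => j _; apply: sqr_ge0.
Qed.

Lemma sqdist_le0 x z : sqdist x z <= 0 -> x = z.
Proof.
move=> H; apply/rowP => i; apply/eqP; rewrite -subr_eq0 -sqrf_eq0 eq_le.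
by rewrite sqr_ge0 (le_trans (sqdist_coord x z i)).
Qed.

Lemma first_order x z :
  f x + \sum_i partial f i x * (z 0 i - x 0 i) + mu / 2 * sqdist z x <= f z.
Proof.
set S := sqdist z x.
(* Strong convexity on the segment from [x] to [z], expanded in [t]: the linear coefficient is
   [f z - f x - mu / 2 * S] and the quadratic one [mu / 2 * S]. *)
have : 'D_(z - x) f x <= 'D_0 f x + (f z - f x - mu / 2 * S).
  apply: (@derive_le _ _ f x x (z - x) 0 1 _ (mu / 2 * S)) => // t /andP[t0 t1].
  have := @fconv z x t ltac:(apply/andP; split; lra).
  rewrite scaler0 addr0 -/S.
  have -> : t *: z + (1 - t) *: x = x + t *: (z - x).
    by apply/rowP => i; rewrite !mxE; ring.
  lra.
rewrite !derive_partial// [X in _ <= X + _]big1 ?add0r; last first.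
  by move=> i _; rewrite mxE mul0r.
rewrite (eq_bigr (fun i => partial f i x * (z 0 i - x 0 i))); first by lra.
by move=> i _; rewrite !mxE mulrC.
Qed.

Lemma obj_first_order x z :
  obj x + \sum_i (partial f i x - a 0 i) * (z 0 i - x 0 i) + mu / 2 * sqdist z x
  <= obj z.
Proof.
have := first_order x z.
have -> : \sum_i (partial f i x - a 0 i) * (z 0 i - x 0 i) =
  \sum_i partial f i x * (z 0 i - x 0 i)
  - \sum_i a 0 i * z 0 i + \sum_i a 0 i * x 0 i.
  by rewrite -sumrB -big_split /=; apply: eq_bigr => i _; ring.
lra.
Qed.

Lemma obj_le x z :
  (forall i, 0 <= (partial f i x - a 0 i) * (z 0 i - x 0 i)) -> obj x <= obj z.
Proof.
move=> H; apply: le_trans (obj_first_order x z).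
rewrite -addrA lerDl addr_ge0//; first by apply: sumr_ge0 => i _; apply: H.
by rewrite mulr_ge0 ?sqdist_ge0// divr_ge0// ltW.
Qed.

(** Add [first_order] for the pairs [(x, z)] and [(z, x)]; the function values cancel. *)
Lemma strongly_monotone x z :
  mu * sqdist x z
  <= \sum_i (partial f i x - partial f i z) * (x 0 i - z 0 i).
Proof.
have := first_order x z; have := first_order z x; rewrite (sqdistC z x).
have -> : \sum_i (partial f i x - partial f i z) * (x 0 i - z 0 i) =
  - (\sum_i partial f i x * (z 0 i - x 0 i)
     + \sum_i partial f i z * (x 0 i - z 0 i)).
  by rewrite -big_split /= -sumrN; apply: eq_bigr => i _; ring.
lra.
Qed.

(** Apply submodularity to [x + t *: delta_mx 0 i] and [z]: since the two points agree at [i], the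
    minimum is [x] and the maximum is [z + t *: delta_mx 0 i]. Hence the increment of [f] in
    direction [i] is no larger at [z] than at [x]. *)
Lemma partial_antitone x z i :
  (forall j, x 0 j <= z 0 j) -> x 0 i = z 0 i -> partial f i z <= partial f i x.
Proof.
move=> xz xzi; rewrite -[leRHS]addr0 /partial.
apply: (@derive_le _ _ f x z _ _ 1 0 0) => // t /andP[t0 _].
rewrite mulr0 addr0 mulr0 addr0.
have := fsub (x + t *: delta_mx 0 i) z.
have -> : \row_j Num.min ((x + t *: delta_mx 0 i) 0 j) (z 0 j) = x.
  apply/rowP => j; rewrite !mxE; case: (eqVneq j i) => [->|_].
    by rewrite -xzi !mulr1 min_r// lerDl ltW.
  by rewrite mulr0 addr0 min_l.
have -> : \row_j Num.max ((x + t *: delta_mx 0 i) 0 j) (z 0 j)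
  = z + t *: delta_mx 0 i.
  apply/rowP => j; rewrite !mxE; case: (eqVneq j i) => [->|_].
    by rewrite xzi !mulr1 max_l// lerDl ltW.
  by rewrite mulr0 !addr0 max_r.
lra.
Qed.

(** Compactness gives a minimizer within a cube around [x0]; outside the cube the quadratic term of
    [obj_first_order] at [x0] outweighs the linear one, so no point there beats [x0]. *)
Lemma exists_box_minimizer (I : 'I_n -> set R) (x0 : 'rV[R]_n) :
  (forall i, closed (I i)) -> (forall i, I i (x0 0 i)) ->
  exists2 x : 'rV[R]_n, forall i, I i (x 0 i) &
    forall z, (forall i, I i (z 0 i)) -> obj x <= obj z.
Proof.
move=> cI I0.
pose g i := partial f i x0 - a 0 i.
pose c := \sum_i `|g i|.
(* Chosen so that [mu / 2 * M] is at least [c], the sum of the absolute slopes at [x0]. *)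
pose M := 2 / mu * c + 1.
have c0 : 0 <= c by apply: sumr_ge0.
have M1 : 1 <= M by rewrite lerDr mulr_ge0// divr_ge0 ?ltW.
pose J i := (I i `&` `[x0 0 i - M, x0 0 i + M])%classic.
pose A := [set v : 'rV[R]_n | forall i, J i (v ord0 i)]%classic.
have AP z : (forall i, I i (z 0 i)) -> (forall i, `|z 0 i - x0 0 i| <= M) ->
    z \in A.
  move=> Iz zM; rewrite inE => i; split; first exact: Iz.
  rewrite /= in_itv /=; have /ler_normlP[] := zM i => h1 h2.
  by apply/andP; split; lra.
have cA : compact A.
  apply: (@rV_compact R n J) => i.
  rewrite /J setIC; apply: compact_closedI => //.
  exact: segment_compact.
have cobj : continuous (fun x : 'rV[R]_n => obj x).
  move=> x.
  have cf : (f y @[y --> x] --> f x)%classic by exact: differentiable_continuous.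
  apply: (cvgB cf).
  apply: cvg_big => [|i _]; first exact: add_continuous.
  apply: cvgM; first exact: cvg_cst.
  exact: coord_continuous.
have x0A : x0 \in A by apply: AP => // i; rewrite subrr normr0; lra.
have [|x xA xmin] := @EVT_min_rV R n (fun x => obj x) A _ cA
  (continuous_subspaceT cobj).
  by exists x0; move: x0A; rewrite inE.
exists x => [i|z Iz]; first by move: xA; rewrite inE => /(_ i)[].
have [zM|] := pselect (forall i, `|z 0 i - x0 0 i| <= M).
  by apply: xmin; apply: AP.
move=> /existsNP[i0 /negP]; rewrite -ltNge => i0M.
apply: le_trans (xmin _ x0A) _; apply: le_trans (obj_first_order x0 z).
rewrite -addrA lerDl.
(* With [m] the largest displacement, the linear term is at least [- (c * m)], while the squared
   distance is at least [m ^+ 2] with [M <= m]. *)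
have [i1 _ i1max] := @arg_maxP _ _ _ i0 xpredT (fun i => `|z 0 i - x0 0 i|) isT.
set m := `|z 0 i1 - x0 0 i1| in i1max *.
have mM : M <= m by apply: le_trans (ltW i0M) (i1max i0 _).
have m0 : 0 <= m by lra.
have h1 : - (c * m) <= \sum_i (partial f i x0 - a 0 i) * (z 0 i - x0 0 i).
  rewrite mulr_suml -sumrN; apply: ler_sum => i _.
  apply: (@le_trans _ _ (- `|g i * (z 0 i - x0 0 i)|)).
    by rewrite lerN2 normrM ler_wpM2l//; apply: i1max.
  by rewrite lerNl -normrN ler_norm.
have h2 : m ^+ 2 <= sqdist z x0.
  apply: le_trans (sqdist_coord z x0 i1).
  by rewrite /m -normrX ger0_norm// sqr_ge0.
have h3 : mu / 2 * m ^+ 2 <= mu / 2 * sqdist z x0.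
  by rewrite ler_wpM2l// divr_ge0// ltW.
have h4 : c * m <= mu / 2 * m ^+ 2.
  rewrite expr2 mulrA ler_wpM2r//.
  have : mu / 2 * M <= mu / 2 * m by rewrite ler_wpM2l// divr_ge0// ltW.
  have -> : mu / 2 * M = c + mu / 2 by rewrite /M; field; rewrite gt_eqF.
  by move=> h; apply: le_trans h; rewrite lerDl divr_ge0// ltW.
lra.
Qed.

Lemma sum_shift x i (t : R) :
  \sum_j a 0 j * (x + t *: delta_mx 0 i) 0 j = \sum_j a 0 j * x 0 j + t * a 0 i.
Proof.
have -> : t * a 0 i = \sum_j a 0 j * (t * (j == i)%:R).
  rewrite (bigD1 i)//= eqxx mulr1 mulrC big1 ?addr0// => j ji.
  by rewrite (negPf ji) !mulr0.
by rewrite -big_split /=; apply: eq_bigr => j _; rewrite !mxE; ring.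
Qed.

(** Only small upward moves of coordinate [i] have to stay in [S], so the test also serves at points
    where other moves are blocked. *)
Lemma minimizer_partial_ge (S : set 'rV[R]_n) x i (e : R) :
  0 < e -> (forall z, S z -> obj x <= obj z) ->
  (forall t, 0 < t <= e -> S (x + t *: delta_mx 0 i)) ->
  a 0 i <= partial f i x.
Proof.
move=> e0 xmin Sx.
have : 'D_0 f x <= partial f i x + - a 0 i.
  apply: (@derive_le _ _ f x x _ _ e _ 0) => // t te.
  have := xmin _ (Sx t te).
  rewrite scaler0 addr0 subrr mulr0 addr0.
  rewrite sum_shift.
  lra.
rewrite derive_partial// big1; first by lra.
by move=> j _; rewrite mxE mul0r.
Qed.

Lemma minimizer_partial_le (S : set 'rV[R]_n) x i (e : R) :
  0 < e -> (forall z, S z -> obj x <= obj z) ->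
  (forall t, 0 < t <= e -> S (x - t *: delta_mx 0 i)) ->
  partial f i x <= a 0 i.
Proof.
move=> e0 xmin Sx.
have : 'D_0 f x <= 'D_(- delta_mx 0 i) f x + a 0 i.
  apply: (@derive_le _ _ f x x _ _ e _ 0) => // t te.
  have := xmin _ (Sx t te).
  rewrite scaler0 addr0 subrr mulr0 addr0 scalerN -scaleNr.
  rewrite sum_shift.
  lra.
rewrite !derive_partial// big1; last by move=> j _; rewrite mxE mul0r.
rewrite (bigD1 i)//= big1 => [|j ji]; rewrite !mxE ?eqxx.
  by rewrite addr0 mulN1r; lra.
by rewrite (negPf ji) andbF oppr0 mul0r.
Qed.

(** * Points with prescribed coordinates and partial derivatives *)

Definition solves (F : pred 'I_n) (b : 'I_n -> R) x : Prop :=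
  forall i, if F i then partial f i x = a 0 i else x 0 i = b i.

(** Minimize with the coordinates outside [F] pinned to [b]; a coordinate in [F] can move both ways,
    so its partial derivative equals [a 0 i]. *)
Lemma solves_exists F b : exists x, solves F b x.
Proof.
pose I i := (if F i then [set: R] else [set b i])%classic.
have [||x xI xmin] := @exists_box_minimizer I (\row_i b i).
- move=> i; rewrite /I; case: (F i); first exact: closedT.
  exact: closed_eq.
- by move=> i; rewrite /I mxE; case: (F i).
exists x => i; case: ifPn => [Fi|nFi]; last first.
  by have := xI i; rewrite /I (negPf nFi).
have shift t j : I j ((x + t *: delta_mx 0 i) 0 j).
  rewrite /I; case: ifPn => // nFj; have := xI j; rewrite /I (negPf nFj) /= => <-.
  rewrite !mxE (_ : j == i = false) ?andbF ?mulr0 ?addr0//.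
  by apply: contraNF nFj => /eqP ->.
apply/eqP; rewrite eq_le; apply/andP; split.
- apply: (minimizer_partial_le ltr01 xmin (i := i)) => t _ j.
  by rewrite -scaleNr; apply: shift.
- by apply: (minimizer_partial_ge ltr01 xmin (i := i)) => t _ j; apply: shift.
Qed.

(** Off [F], the minimum [m] agrees with [x] and the maximum [M] with [x'], so the linear terms of
    [obj_first_order] vanish. Adding both inequalities to submodularity leaves [sqdist m x <= 0],
    that is, [m = x]. *)
Lemma solves_le F b b' x x' : solves F b x -> solves F b' x' ->
  (forall i, ~~ F i -> b i <= b' i) -> forall i, x 0 i <= x' 0 i.
Proof.
move=> sx sx' bb'.
pose m : 'rV[R]_n := \row_i Num.min (x 0 i) (x' 0 i).
pose M : 'rV[R]_n := \row_i Num.max (x 0 i) (x' 0 i).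
have hm : obj x + mu / 2 * sqdist m x <= obj m.
  have := obj_first_order x m; rewrite [X in _ + X + _ <= _]big1 ?addr0// => i _.
  have := sx i; case: ifPn => [Fi ->|nFi xi]; first by rewrite subrr mul0r.
  have := sx' i; rewrite (negPf nFi) => x'i.
  by rewrite mxE xi x'i min_l ?bb'// subrr mulr0.
have hM : obj x' + mu / 2 * sqdist M x' <= obj M.
  have := obj_first_order x' M; rewrite [X in _ + X + _ <= _]big1 ?addr0// => i _.
  have := sx' i; case: ifPn => [Fi ->|nFi x'i]; first by rewrite subrr mul0r.
  have := sx i; rewrite (negPf nFi) => xi.
  by rewrite mxE xi x'i max_r ?bb'// subrr mulr0.
have hs := fsub x x'; rewrite -/m -/M in hs.
have ha : \sum_i a 0 i * m 0 i + \sum_i a 0 i * M 0 i =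
          \sum_i a 0 i * x 0 i + \sum_i a 0 i * x' 0 i.
  rewrite -!big_split /=; apply: eq_bigr => i _.
  by rewrite !mxE -!mulrDr addr_min_max.
have hM0 : 0 <= mu / 2 * sqdist M x'.
  by rewrite mulr_ge0 ?sqdist_ge0// divr_ge0// ltW.
have : sqdist m x <= 0.
  rewrite -(@pmulr_rle0 _ (mu / 2)) ?divr_gt0//; lra.
move=> /sqdist_le0 mx i; rewrite -mx mxE ge_min lexx; exact: orbT.
Qed.

Lemma solves_unique F b x x' : solves F b x -> solves F b x' -> x = x'.
Proof.
move=> sx sx'; apply/rowP => i; apply/eqP; rewrite eq_le.
by rewrite (solves_le sx sx')// (solves_le sx' sx).
Qed.

(** In the sum of [strongly_monotone] every coordinate other than [p] drops out: either the partial
    derivatives or the coordinates coincide. *)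
Lemma sqdist_solves F b b' x x' p : solves F b x -> solves F b' x' ->
  (forall i, i != p -> ~~ F i -> b i = b' i) ->
  mu * sqdist x x' <= (partial f p x - partial f p x') * (x 0 p - x' 0 p).
Proof.
move=> sx sx' bb'; apply: le_trans (strongly_monotone x x') _.
rewrite (bigD1 p)//= big1 ?addr0// => i ip.
have := sx i; have := sx' i; case: ifPn => [Fi -> ->|nFi -> ->].
  by rewrite subrr mul0r.
by rewrite bb'// subrr mulr0.
Qed.

Definition upd (b : 'I_n -> R) p (y : R) i := if i == p then y else b i.

Definition solution_curve F b p (X : R -> 'rV[R]_n) : Prop :=
  ~~ F p /\ forall y, solves F (upd b p y) (X y).

Lemma solution_curve_exists F b p : ~~ F p -> exists X, solution_curve F b p X.
Proof.
move=> Fp; have /choice[X XP] y := solves_exists F (upd b p y).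
by exists X.
Qed.

(** * Monotonicity, continuity and roots along the curve *)

Section Curve.
Variables (F : pred 'I_n) (b : 'I_n -> R) (p : 'I_n) (X : R -> 'rV[R]_n).
Hypothesis cX : solution_curve F b p X.

Lemma curve_driven y : X y 0 p = y.
Proof.
by case: cX => Fp /(_ y p); rewrite (negPf Fp) /upd eqxx.
Qed.

Lemma curve_fixed y i : ~~ F i -> i != p -> X y 0 i = b i.
Proof.
by move=> Fi ip; case: cX => _ /(_ y i); rewrite (negPf Fi) /upd (negPf ip).
Qed.

Lemma curve_le y y' i : y <= y' -> X y 0 i <= X y' 0 i.
Proof.
move=> yy'; case: cX => _ sX; apply: (solves_le (sX y) (sX y')) => j _.
by rewrite /upd; case: ifP.
Qed.

Lemma curve_partial_le y y' i : y <= y' -> ~~ F i -> i != p ->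
  partial f i (X y') <= partial f i (X y).
Proof.
move=> yy' Fi ip; apply: partial_antitone => [j|]; first exact: curve_le.
by rewrite !curve_fixed.
Qed.

Lemma curve_sqdist y y' :
  mu * sqdist (X y) (X y')
  <= (partial f p (X y) - partial f p (X y')) * (y - y').
Proof.
case: cX => _ sX; rewrite -{3}(curve_driven y) -{3}(curve_driven y').
apply: (sqdist_solves (sX y) (sX y')) => i ip _.
by rewrite /upd (negPf ip).
Qed.

Lemma curve_partial_driven_lt y y' : y < y' ->
  partial f p (X y) < partial f p (X y').
Proof.
move=> yy'; have := curve_sqdist y' y.
have : 0 < mu * sqdist (X y') (X y).
  rewrite mulr_gt0// lt_neqAle sqdist_ge0 andbT eq_sym; apply/eqP => s0.
  have /(congr1 (fun x : 'rV_n => x 0 p)) : X y' = X y.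
    by apply: sqdist_le0; rewrite s0.
  by rewrite !curve_driven => e; move: yy'; rewrite e ltxx.
move=> h1 h2; have := lt_le_trans h1 h2.
by rewrite pmulr_lgt0 ?subr_gt0.
Qed.

Lemma curve_partial_driven_le y y' : y <= y' ->
  partial f p (X y) <= partial f p (X y').
Proof.
rewrite le_eqVlt => /orP[/eqP -> //|yy'].
by apply: ltW; apply: curve_partial_driven_lt.
Qed.

(* Strong monotonicity makes the curve 1/2-Hoelder on bounded intervals, so no
   continuity of the partial derivatives is needed. *)
Lemma curve_continuous i : continuous (fun y => X y 0 i).
Proof.
move=> y; apply/cvgrPdist_lt => e e0.
(* The driven partial derivative is monotone, so on the unit neighbourhood of [y] its variation is
   at most [mu * K]. *)
pose K := (partial f p (X (y + 1)) - partial f p (X (y - 1))) / mu.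
have K0 : 0 <= K.
  by rewrite divr_ge0 ?(ltW mu0)// subr_ge0 curve_partial_driven_le//; lra.
have d0 : 0 < Num.min 1 (e ^+ 2 / (K + 1)).
  by rewrite lt_min ltr01 divr_gt0 ?exprn_gt0//; lra.
near=> y'.
have : `|y - y'| < Num.min 1 (e ^+ 2 / (K + 1)).
  by near: y'; apply: cvgr_dist_lt.
rewrite lt_min => /andP[d1 d2].
have hK : mu * sqdist (X y) (X y') <= mu * K * `|y - y'|.
  apply: le_trans (curve_sqdist y y') _.
  rewrite (le_trans (ler_norm _))// normrM ler_wpM2r// /K mulrC divfK ?gt_eqF//.
  move: d1 => /ltr_normlP[h1 h2].
  have m1 : partial f p (X (y - 1)) <= partial f p (X y).
    by rewrite curve_partial_driven_le//; lra.
  have m2 : partial f p (X y) <= partial f p (X (y + 1)).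
    by rewrite curve_partial_driven_le//; lra.
  have m3 : partial f p (X (y - 1)) <= partial f p (X y').
    by rewrite curve_partial_driven_le//; lra.
  have m4 : partial f p (X y') <= partial f p (X (y + 1)).
    by rewrite curve_partial_driven_le//; lra.
  by apply/ler_normlP; split; lra.
rewrite -(@ltr_pXn2r _ 2) ?nnegrE ?normr_ge0 ?(ltW e0)//.
rewrite -normrX ger0_norm ?sqr_ge0//.
apply: le_lt_trans (sqdist_coord _ _ i) _.
apply: (@le_lt_trans _ _ (K * `|y - y'|)).
  by rewrite -(ler_pM2l mu0) mulrA.
apply: (@le_lt_trans _ _ ((K + 1) * `|y - y'|)).
  by rewrite ler_wpM2r//; lra.
by rewrite mulrC -ltr_pdivlMr//; lra.
Unshelve. all: by end_near. Qed.

Lemma curve_ivt i c y y' : y <= y' -> X y 0 i <= c -> c <= X y' 0 i ->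
  exists2 t, y <= t <= y' & X t 0 i = c.
Proof.
move=> yy' h h'.
have cont : {within `[y, y'], continuous (fun y => X y 0 i)}%classic.
  by apply: continuous_subspaceT; apply: curve_continuous.
have [|t] := IVT yy' cont (v := c).
  by rewrite ge_min le_max h h' orbT.
by rewrite in_itv /= => ty tc; exists t.
Qed.

Lemma curve_no_root_le i c y y' : y <= y' -> X y 0 i <= c ->
  (forall t, X t 0 i <> c) -> X y' 0 i <= c.
Proof.
move=> yy' h no; rewrite leNgt; apply/negP => h'.
by have [t _ /no] := curve_ivt yy' h (ltW h').
Qed.

(** Release [p] as well and solve the enlarged system; by uniqueness its solution lies on the curve,
    at the parameter equal to its [p] coordinate. *)
Lemma curve_partial_driven_root : exists y, partial f p (X y) = a 0 p.
Proof.
have [x sx] := solves_exists (fun i => F i || (i == p)) b.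
exists (x 0 p).
suff -> : X (x 0 p) = x by have := sx p; rewrite eqxx orbT.
case: cX => Fp sX; apply: solves_unique (sX _) _ => i; rewrite /upd.
have := sx i; case: (eqVneq i p) => [->|ip]; last by rewrite orbF.
by rewrite (negPf Fp).
Qed.

End Curve.

(* The root is found on the curve [Z] on which coordinate [i] is released: where
   [Z] takes the value [b i] at [i], it meets [X]. *)
Lemma curve_partial_no_root_ge F b p X i y y' : solution_curve F b p X ->
  ~~ F i -> i != p -> y <= y' -> a 0 i <= partial f i (X y) ->
  (forall t, partial f i (X t) <> a 0 i) -> a 0 i <= partial f i (X y').
Proof.
move=> cX Fi ip yy' h no; rewrite leNgt; apply/negP => h'.
pose G j := F j || (j == i).
have Gp : ~~ G p by rewrite /G negb_or (proj1 cX) eq_sym.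
have [Z cZ] := solution_curve_exists b Gp.
have Zi t : partial f i (Z t) = a 0 i.
  by case: cZ => _ /(_ t i); rewrite /G eqxx orbT.
have sZ t : solves F (upd (upd b p t) i (Z t 0 i)) (Z t).
  move=> j; rewrite {1 2}/upd; case: (eqVneq j i) => [->|ji].
    by rewrite (negPf Fi).
  by have := (proj2 cZ) t j; rewrite /G (negPf ji) orbF.
have Xi t : X t 0 i = b i by rewrite (curve_fixed cX).
have key t : mu * sqdist (X t) (Z t)
    <= (partial f i (X t) - a 0 i) * (b i - Z t 0 i).
  rewrite -(Zi t) -(Xi t).
  apply: (sqdist_solves ((proj2 cX) t) (sZ t)) => j ji _.
  by rewrite {2}/upd (negPf ji).
(* A nonpositive product forces [X t = Z t] by [key], making [t] an excluded root. This fixes the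
   side of [b i] on which [Z] lies at [y] and at [y']. *)
have meet t : (partial f i (X t) - a 0 i) * (b i - Z t 0 i) <= 0 -> False.
  move=> /(le_trans (key t)); rewrite pmulr_rle0// => /sqdist_le0 XZ.
  by apply: (no t); rewrite XZ.
have h1 : Z y 0 i <= b i.
  rewrite leNgt; apply/negP => lt; apply: (meet y).
  by rewrite mulr_ge0_le0 ?subr_ge0// subr_le0 ltW.
have h2 : b i <= Z y' 0 i.
  rewrite leNgt; apply/negP => lt; apply: (meet y').
  by rewrite mulr_le0_ge0 ?subr_le0 ?subr_ge0 ?(ltW h')// ltW.
have [t _ Zt] := curve_ivt cZ yy' h1 h2.
by apply: (meet t); rewrite Zt subrr mulr0.
Qed.

End Optimization.

(** * The pivot subroutine *)

Section Pivoting.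
Variables (R : realType) (n1 n2 : nat) (f : 'rV[R]_(n1 + n2) -> R).
Variables (a : 'rV[R]_(n1 + n2)) (l u : 'rV[R]_n1) (mu : R).
Hypothesis df : forall x, differentiable f x.
Hypothesis mu0 : 0 < mu.
Hypothesis fconv : forall (x y : 'rV[R]_(n1 + n2)) (t : R), 0 <= t <= 1 ->
  f (t *: x + (1 - t) *: y)
  <= t * f x + (1 - t) * f y
     - mu / 2 * t * (1 - t) * \sum_i (x 0 i - y 0 i) ^+ 2.
Hypothesis fsub : submodular f.
Hypothesis lu : forall i, l 0 i <= u 0 i.

Local Notation point := ('rV[R]_(n1 + n2)).
Local Notation index := ('I_(n1 + n2)).
Local Notation lab := (labelling n1 n2).
Implicit Types (st : lab) (x z : point) (p i : index) (X : R -> point).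

Lemma pad_le i : pad n2 l 0 i <= pad n2 u 0 i.
Proof.
rewrite -(splitK i); case: (fintype.split i) => j /=.
  by rewrite !row_mxEl.
by rewrite !row_mxEr !mxE.
Qed.

Definition is_free (o : option label) : bool :=
  if o is Some (AlphaPlus | BetaMinus | BetaPlus) then true else false.

Definition fixed_value st i : R :=
  match st i with
  | Some AlphaLow => pad n2 l 0 i
  | Some AlphaUp => pad n2 u 0 i
  | _ => 0
  end.

Definition driven st p : Prop := forall i, st i = None <-> i = p.

(** Turns the labels into a system [solves] in which the driving index is one of the pinned
    coordinates, so that existence, uniqueness and comparison apply. *)
Lemma point_of_driven st p x y : driven st p ->
  (x 0 p = y /\ point_of f a l u st x) <->
  solves f a (fun i => is_free (st i)) (upd (fixed_value st) p y) x.
Proof.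
move=> dp; have stp : st p = None by apply/dp.
split=> [[xp px] i|sx].
  have := px i; rewrite /upd /fixed_value; case: (eqVneq i p) => [->|ip].
    by rewrite stp.
  by case: (st i) (dp i) => [[]//|[/(_ erefl) e _]]; rewrite e eqxx in ip.
split=> [|i]; first by have := sx p; rewrite stp /upd eqxx.
have := sx i; rewrite /upd /fixed_value; case: (eqVneq i p) => [->|ip].
  by rewrite stp.
by case: (st i) => [[]|].
Qed.

Lemma point_of_labelled st x : (forall i, st i <> None) ->
  point_of f a l u st x <->
  solves f a (fun i => is_free (st i)) (fixed_value st) x.
Proof.
move=> nst; split=> px i; have := px i; rewrite /fixed_value;
  by case: (st i) (nst i) => [[]|].
Qed.

Lemma curve_of_solution st p X : driven st p ->
  curve_of f a l u st p X <->
  solution_curve f a (fun i => is_free (st i)) (fixed_value st) p X.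
Proof.
move=> dp; split=> [cX|[_ sX] y]; last exact/point_of_driven.
split=> [|y]; last exact/point_of_driven.
by have -> : st p = None by apply/dp.
Qed.

Lemma point_of_exists st : (forall i, st i <> None) ->
  exists x, point_of f a l u st x.
Proof.
move=> nst.
have [x sx] := solves_exists a df mu0 fconv
  (fun i => is_free (st i)) (fixed_value st).
by exists x; apply/point_of_labelled.
Qed.

Lemma point_of_unique st x z : (forall i, st i <> None) ->
  point_of f a l u st x -> point_of f a l u st z -> x = z.
Proof.
move=> nst /(point_of_labelled _ nst) sx /(point_of_labelled _ nst) sz.
exact: (solves_unique df mu0 fconv fsub sx sz).
Qed.

Lemma curve_of_exists st p : driven st p -> exists X, curve_of f a l u st p X.
Proof.
move=> dp; have Fp : ~~ is_free (st p) by have -> : st p = None by apply/dp.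
have [X cX] := solution_curve_exists a df mu0 fconv (fixed_value st)
  (F := fun i => is_free (st i)) Fp.
by exists X; apply/curve_of_solution.
Qed.

Lemma curve_of_point st p X x : driven st p -> curve_of f a l u st p X ->
  point_of f a l u st x -> X (x 0 p) = x.
Proof.
move=> dp cX px.
have sx := proj1 (point_of_driven x (x 0 p) dp) (conj erefl px).
have sX := proj1 (point_of_driven _ _ dp) (cX (x 0 p)).
exact: (solves_unique df mu0 fconv fsub sX sx).
Qed.

(* The optimality conditions of an index carrying label [q]. *)
Definition label_ok x i (q : option label) : Prop :=
  match q with
  | None => True
  | Some (Alpha0 | Beta0) => x 0 i = 0
  | Some AlphaLow => x 0 i = pad n2 l 0 i /\ a 0 i <= partial f i x
  | Some AlphaPlus => partial f i x = a 0 i /\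
                      pad n2 l 0 i <= x 0 i <= pad n2 u 0 i
  | Some AlphaUp => x 0 i = pad n2 u 0 i /\ partial f i x <= a 0 i
  | Some BetaMinus => partial f i x = a 0 i /\ x 0 i <= 0
  | Some BetaOminus => x 0 i = 0 /\ partial f i x <= a 0 i
  | Some BetaOplus => x 0 i = 0 /\ a 0 i <= partial f i x
  | Some BetaPlus => partial f i x = a 0 i /\ 0 <= x 0 i
  end.

Definition consistent st x : Prop := forall i, label_ok x i (st i).

Lemma consistent_set st p x q : consistent st x -> label_ok x p q ->
  consistent (set_label st p q) x.
Proof.
move=> cx H i; rewrite /set_label; case: (eqVneq i p) => [->|_]; first exact: H.
exact: cx.
Qed.

Lemma consistent_point st x : consistent st x -> point_of f a l u st x.
Proof. by move=> cx i; have := cx i; case: (st i) => [[]|] // []. Qed.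

(** If an equation has a root at or beyond [t], monotonicity turns the equality there into the
    needed inequality at [t]; if it has none, an intermediate value argument forbids crossing. Any
    root may therefore serve as [r i]. Labels without a breakpoint persist by monotonicity alone. *)
Lemma consistent_advance st p X x (r : index -> \bar R) (t : R) :
  driven st p -> curve_of f a l u st p X -> consistent st x -> x 0 p <= t ->
  (forall i, breakpoint f a u st X i (r i)) ->
  (t = x 0 p \/ forall i, (t%:E <= r i)%E) -> consistent st (X t).
Proof.
move=> dp cX cx xt hr [->|tr].
  by rewrite (curve_of_point dp cX (consistent_point cx)).
have /(curve_of_solution _ dp) sX := cX.
have Xx : X (x 0 p) = x by apply: curve_of_point (consistent_point cx).
have ptX := proj2 (cX t).
have inc i : x 0 i <= X t 0 i.
  by rewrite -{1}Xx; apply: (curve_le df mu0 fconv fsub sX).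
have incr i y : t <= y -> X t 0 i <= X y 0 i.
  by apply: (curve_le df mu0 fconv fsub sX).
have dec i y y' : y <= y' -> ~~ is_free (st i) -> i != p ->
    partial f i (X y') <= partial f i (X y).
  by apply: (curve_partial_le df mu0 fconv fsub sX).
have no_root_le i c : x 0 i <= c -> (forall y, X y 0 i <> c) -> X t 0 i <= c.
  by rewrite -{1}Xx => h; apply: (curve_no_root_le df mu0 fconv sX xt h).
have no_root_ge i : ~~ is_free (st i) -> i != p -> a 0 i <= partial f i x ->
    (forall y, partial f i (X y) <> a 0 i) -> a 0 i <= partial f i (X t).
  move=> Fi ip; rewrite -{1}Xx => h.
  exact: (curve_partial_no_root_ge df mu0 fconv sX Fi ip xt h).
move=> i; have := tr i; have := hr i; have := cx i; have := ptX i.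
rewrite /breakpoint; case sti : (st i) => [lb|//].
have ip : i != p by apply/eqP => /dp; rewrite sti.
have decx : ~~ is_free (st i) -> partial f i (X t) <= partial f i x.
  by rewrite -{1}Xx => Fi; apply: dec.
case: lb sti => sti //=; rewrite sti /= in decx.
- move=> -> [_ ai] br ty; split=> //; case: br ty => [[y hy ->]|[no _] _].
    rewrite lee_fin => ty; apply: le_trans (dec i _ _ ty _ ip); last by rewrite sti.
    lra.
  apply: no_root_ge => //; first by rewrite sti.
  by move=> y hy; apply: (no y); rewrite hy subrr.
- move=> -> [_ /andP[lx xu]] br ty; split=> //; rewrite (le_trans lx)//=.
  case: br ty => [[y hy ->]|[no _] _].
    by rewrite lee_fin => /(incr i) h; lra.
  by apply: no_root_le => // y hy; apply: (no y); rewrite hy subrr.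
- by move=> -> [_ h] _ _; split=> //; apply: le_trans h; apply: decx.
- move=> -> [_ x0] br ty; split=> //; case: br ty => [[y hy ->]|[no _] _].
    by rewrite lee_fin => /(incr i) h; lra.
  exact: no_root_le.
- by move=> -> [_ h] _ _; split=> //; apply: le_trans h; apply: decx.
- move=> -> [_ ai] br ty; split=> //; case: br ty => [[y hy ->]|[no _] _].
    rewrite lee_fin => ty; apply: le_trans (dec i _ _ ty _ ip); last by rewrite sti.
    lra.
  apply: no_root_ge => //; first by rewrite sti.
  by move=> y hy; apply: (no y); rewrite hy subrr.
- by move=> -> [_ h] _ _; split=> //; apply: le_trans h (inc i).
Qed.

(* The root may lie strictly below [t], when its equation is constant near it;
   then monotonicity along the curve makes the equation hold at [t] as well. *)
Lemma consistent_move st p X i (y t : R) :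
  driven st p -> curve_of f a l u st p X -> consistent st (X t) -> y <= t ->
  breakpoint f a u st X i y%:E ->
  consistent (set_label st i (moved (st i))) (X t).
Proof.
move=> dp cX ct yt hr; apply: consistent_set => //.
have /(curve_of_solution _ dp) sX := cX.
have incr : X y 0 i <= X t 0 i by apply: (curve_le df mu0 fconv fsub sX).
have dec : ~~ is_free (st i) -> i != p -> partial f i (X t) <= partial f i (X y).
  exact: (curve_partial_le df mu0 fconv fsub sX).
have ip : st i <> None -> i != p by move=> sti; apply/eqP => /dp.
have root E : root_or_infty E y%:E -> E y.
  by case=> [[y' Ey' [->]]//|[_]].
have := ct i; move: hr; rewrite /breakpoint.
case: (st i) dec ip => [[]|] //= dec ip.
- move=> /root /= hy [xi ai]; split; last by rewrite xi lexx pad_le.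
  by apply/eqP; rewrite eq_le ai andbT; have := dec isT (ip ltac:(by [])); lra.
- move=> /root /= hy [ai /andP[_ xu]]; split; last by rewrite ai.
  by apply/eqP; rewrite eq_le xu; lra.
- move=> /root /= hy [ai x0]; split; last by rewrite ai.
  by apply/eqP; rewrite eq_le x0; lra.
- move=> /root /= hy [xi ai]; split; last by rewrite xi.
  by apply/eqP; rewrite eq_le ai andbT; have := dec isT (ip ltac:(by [])); lra.
Qed.

(** * Contract and executability of a call of [pivot] *)

Definition movable (o : option label) : bool :=
  if o is Some (AlphaLow | AlphaPlus | BetaMinus | BetaOplus) then true else false.

Lemma pivot_spec st p x (y0 ybar y : R) st' :
  driven st p -> consistent st x -> x 0 p <= ybar ->
  pivot f a l u st p y0 ybar y st' ->
  exists x', [/\ consistent st' x', point_of f a l u st x', x 0 p <= x' 0 p <= ybar,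
    y <= x' 0 p &
    (y = ybar /\ st' = st) \/
    (y < ybar /\ exists2 i, movable (st i) &
       st' = set_label st i (moved (st i)))].
Proof.
move=> dp cx xybar [X [r [i [cX hr rmin ey ->]]]].
(* The returned [y] may lie behind [x]; the consistent point then stays where it is. *)
pose t := Num.max (x 0 p) y.
have Xp : X t 0 p = t by have [] := cX t.
have yybar : y <= ybar by rewrite -lee_fin ey ge_min lexx orbT.
have yr j : (y%:E <= r j)%E.
  by rewrite (le_trans _ (rmin j))// ey ge_min lexx.
have ct : consistent st (X t).
  apply: (consistent_advance dp cX cx _ hr); first by rewrite le_max lexx.
  rewrite /t; case: (leP (x 0 p) y) => h; last by left; lra.
  by right.
exists (X t); rewrite Xp; split.
- case: ifP => // ylt; apply: (consistent_move dp cX ct (y := y)).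
    by rewrite /t le_max lexx orbT.
  have := hr i; have -> // : r i = y%:E.
  by move: ey; rewrite minEle; case: ifP => // _ [e]; rewrite e ltxx in ylt.
- by have [] := cX t.
- by rewrite /t le_max lexx ge_max xybar yybar.
- by rewrite /t le_max lexx orbT.
- case: ifPn => [ylt|nlt]; [right|left]; last first.
    by split=> //; apply/eqP; rewrite eq_le yybar leNgt.
  split=> //; exists i => //.
  have : r i = y%:E.
    by move: ey; rewrite minEle; case: ifP => // _ [e]; rewrite e ltxx in ylt.
  by have := hr i; rewrite /breakpoint; case: (st i) => [[]|] //= ->.
Qed.

Lemma root_or_infty_exists (E : R -> Prop) : exists r, root_or_infty E r.
Proof.
have [[y Ey]|nE] := pselect (exists y, E y); first by exists y%:E; left; exists y.
by exists +oo%E; right; split=> // y Ey; apply: nE; exists y.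
Qed.

Lemma pivot_exists st p (y0 ybar : R) : driven st p ->
  exists y st', pivot f a l u st p y0 ybar y st'.
Proof.
move=> dp; have [X cX] := curve_of_exists dp.
have /choice[r hr] i : exists r, breakpoint f a u st X i r.
  rewrite /breakpoint; case: (st i) => [[]|]; try (by exists +oo%E);
  exact: root_or_infty_exists.
have [i _ imin] := @arg_minP _ _ _ p xpredT r isT.
(* With [-oo] excluded, the minimum with the finite [ybar] is a real number even when no equation
   has a root. *)
have rN : (r i != -oo)%E.
  have root E : root_or_infty E (r i) -> (r i != -oo)%E.
    by case=> [[y _ ->]|[_ ->]].
  have := hr i; rewrite /breakpoint; case: (st i) => [[]|];
    by [exact: root | move=> ->].
have [y ey] : exists y : R, y%:E = Order.min (r i) ybar%:E.
  case: (r i) rN => [s| |] // _; first by exists (Num.min s ybar); rewrite EFin_min.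
  by exists ybar; rewrite min_r// leey.
exists y, (if y < ybar then set_label st i (moved (st i)) else st).
by exists X, r, i; split=> // j; apply: imin.
Qed.

End Pivoting.

(** * Invariants of a run *)

Section Run.
Variables (R : realType) (n1 n2 : nat) (f : 'rV[R]_(n1 + n2) -> R).
Variables (a : 'rV[R]_(n1 + n2)) (l u : 'rV[R]_n1) (mu : R).
Variable pi : {perm 'I_(n1 + n2 + n2)}.
Hypothesis df : forall x, differentiable f x.
Hypothesis mu0 : 0 < mu.
Hypothesis fconv : forall (x y : 'rV[R]_(n1 + n2)) (t : R), 0 <= t <= 1 ->
  f (t *: x + (1 - t) *: y)
  <= t * f x + (1 - t) * f y
     - mu / 2 * t * (1 - t) * \sum_i (x 0 i - y 0 i) ^+ 2.
Hypothesis fsub : submodular f.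
Hypothesis l0 : forall i, 0 <= l 0 i.
Hypothesis lu : forall i, l 0 i <= u 0 i.
Hypothesis pi_compatible : compatible pi.

Local Notation point := ('rV[R]_(n1 + n2)).
Local Notation index := ('I_(n1 + n2)).
Local Notation item := ('I_(n1 + n2 + n2)).
Local Notation lab := (labelling n1 n2).
Implicit Types (st : lab) (x z : point) (p i : index) (X : R -> point).
Implicit Types (s : item -> bool) (k m : nat) (o : seq R).

Definition coordinate (j : item) : index :=
  match fintype.split j with inl i => i | inr i => rshift n1 i end.

Lemma coordinate_lshift i : coordinate (lshift n2 i) = i.
Proof. by rewrite /coordinate (unsplitK (inl i)). Qed.

Lemma coordinate_rshift (j : 'I_n2) :
  coordinate (rshift (n1 + n2) j) = rshift n1 j.
Proof. by rewrite /coordinate (unsplitK (inr j)). Qed.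

(* The labels that an index may carry when [s] is the current argument of v. *)
Definition fits s i (lb : label) : bool :=
  match fintype.split i with
  | inl j =>
      match s (lshift n2 (lshift n2 j)), lb with
      | false, Alpha0 | true, (AlphaLow | AlphaPlus | AlphaUp) => true
      | _, _ => false
      end
  | inr j =>
      match s (lshift n2 (rshift n1 j)), s (rshift (n1 + n2) j), lb with
      | false, false, (BetaMinus | BetaOminus)
      | true, false, Beta0
      | true, true, (BetaOplus | BetaPlus) => true
      | _, _, _ => false
      end
  end.

Lemma fits_lshift s (j : 'I_n1) lb : fits s (lshift n2 j) lb =
  match s (lshift n2 (lshift n2 j)), lb with
  | false, Alpha0 | true, (AlphaLow | AlphaPlus | AlphaUp) => true
  | _, _ => false
  end.
Proof. by rewrite /fits (unsplitK (inl j)). Qed.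

Lemma fits_rshift s (j : 'I_n2) lb : fits s (rshift n1 j) lb =
  match s (lshift n2 (rshift n1 j)), s (rshift (n1 + n2) j), lb with
  | false, false, (BetaMinus | BetaOminus)
  | true, false, Beta0
  | true, true, (BetaOplus | BetaPlus) => true
  | _, _, _ => false
  end.
Proof. by rewrite /fits (unsplitK (inr j)). Qed.

Lemma fits_eq s s' i lb : (forall j, coordinate j = i -> s j = s' j) ->
  fits s i lb = fits s' i lb.
Proof.
rewrite -(splitK i); case: (fintype.split i) => j /=.
  by move=> H; rewrite !fits_lshift (H _ (coordinate_lshift _)).
move=> H; rewrite !fits_rshift (H _ (coordinate_lshift _)).
by rewrite (H _ (coordinate_rshift _)).
Qed.

Definition labelled s st : Prop :=
  forall i, exists2 lb, st i = Some lb & fits s i lb.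

Definition labelled_but s p st : Prop :=
  st p = None /\ forall i, i != p -> exists2 lb, st i = Some lb & fits s i lb.

Lemma labelled_some s st i : labelled s st -> st i <> None.
Proof. by move=> /(_ i)[lb ->]. Qed.

Lemma labelled_but_driven s p st : labelled_but s p st -> driven st p.
Proof.
move=> [stp H] i; split=> [sti|->//]; apply/eqP/negP => /negP ip.
by have [lb] := H i ip; rewrite sti.
Qed.

Lemma labelled_set s p st lb : labelled_but s p st -> fits s p lb ->
  labelled s (set_label st p (Some lb)).
Proof.
move=> [stp H] fp i; rewrite /set_label; case: (eqVneq i p) => [->|ip].
  by exists lb.
exact: H.
Qed.

Lemma labelled_but_moved s p st i : labelled_but s p st -> movable (st i) ->
  labelled_but s p (set_label st i (moved (st i))).
Proof.
move=> [stp H] mi; split=> [|j jp].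
  by rewrite /set_label; case: eqP => // pi_; rewrite -pi_ stp in mi.
rewrite /set_label; case: (eqVneq j i) => [ji|_]; last exact: H.
have [lb sti] := H j jp; rewrite -ji sti in mi *; move: mi.
rewrite /fits; case: (fintype.split j) => q.
  case: (s (lshift _ _)); case: lb {sti} => // _ _.
  - by exists AlphaPlus.
  - by exists AlphaUp.
case: (s (lshift _ _)); case: (s (rshift _ _)); case: lb {sti} => // _ _.
- by exists BetaPlus.
- by exists BetaOminus.
Qed.

(** By [obj_le] it suffices that each term [(partial f i x - a 0 i) * (z 0 i - x 0 i)] is
    nonnegative for feasible [z]. Either a factor is zero, or [x] sits at a bound where the
    derivative sign opposes every feasible move. *)
Lemma consistent_optimal s st x : labelled s st -> consistent f a l u st x ->
  is_value f a l u s (objective f a x).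
Proof.
move=> L cx; split.
  exists x => //; split=> j /=.
    have [lb stj] := L (lshift n2 j); have := cx (lshift n2 j).
    rewrite stj fits_lshift /label_ok /pad !row_mxEl.
    have := lu j; case: (s (lshift _ _)); case: lb {stj} => //= luj;
      rewrite ?mulr1 ?mulr0.
    - by move=> [-> _] _; rewrite lexx.
    - by case.
    - by move=> [-> _] _; rewrite lexx andbT.
    - by move=> ->; rewrite lexx.
  have [lb stj] := L (rshift n1 j); have := cx (rshift n1 j).
  rewrite stj fits_rshift.
  case: (s (lshift _ _)); case: (s (rshift _ _)); case: lb {stj} => //=;
      rewrite ?subrr ?subr0 ?mulr1 ?mulr0.
  - by move=> [-> _] _; rewrite oppr0 maxxx.
  - by move=> [_ x0] _; split=> //; rewrite max_r// oppr_le0.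
  - by move=> -> _; rewrite oppr0 maxxx.
  - by move=> [_ x0] _; split=> //; rewrite max_r.
  - by move=> [-> _] _; rewrite maxxx.
move=> z [za zb]; rewrite /objective; apply: (obj_le df mu0 fconv) => i.
rewrite -(splitK i); case: (fintype.split i) => j /=.
  have [lb stj] := L (lshift n2 j); have := cx (lshift n2 j).
  have := za j; rewrite /= stj fits_lshift /label_ok /pad !row_mxEl.
  case: (s (lshift _ _)); case: lb {stj} => //=; rewrite ?mulr1 ?mulr0 => /andP[h1 h2].
  - by move=> [xl ha] _; rewrite mulr_ge0// subr_ge0// xl.
  - by move=> [-> _] _; rewrite subrr mul0r.
  - by move=> [xl ha] _; rewrite mulr_le0// subr_le0// xl.
  - by move=> x0 _; rewrite x0 (le_anti (introT andP (conj h2 h1))) subrr mulr0.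
have [lb stj] := L (rshift n1 j); have := cx (rshift n1 j).
have := zb j; rewrite /= stj fits_rshift.
case: (s (lshift _ _)); case: (s (rshift _ _)); case: lb {stj} => //=;
  rewrite ?subrr ?subr0 ?mulr1 ?mulr0 => -[h1 h2].
- move=> [x0 ha] _; rewrite x0 subr0 mulr_ge0 ?subr_ge0//.
  by rewrite -oppr_le0 -h1 le_max lexx.
- by move=> [-> _] _; rewrite subrr mul0r.
- move=> x0 _; rewrite x0; suff -> : z 0 (rshift n1 j) = 0 by rewrite subrr mulr0.
  apply/eqP; rewrite eq_le -{1}h2 le_max lexx /= -oppr_le0 -h1.
  by rewrite le_max lexx.
- by move=> [-> _] _; rewrite subrr mul0r.
- move=> [x0 ha] _; rewrite x0 subr0 mulr_le0 ?subr_le0//.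
  by rewrite -h2 le_max lexx.
Qed.

(** * Prefixes of the permutation and the termination measure *)

Lemma char_prefixE k j : char_prefix pi k j = ((pi^-1)%g j < k)%N.
Proof.
apply/existsP/idP => [[i /andP[ik /eqP <-]]|jk]; first by rewrite permK.
by exists ((pi^-1)%g j); rewrite jk permKV eqxx.
Qed.

(** Passing from [k] to [k.+1] changes the characteristic vector only at an item of coordinate [p],
    so all other labels still fit. *)
Lemma labelled_start k (kN : (k < n1 + n2 + n2)%N) st :
  let p := coordinate (pi (Ordinal kN)) in
  labelled (char_prefix pi k) st ->
  labelled_but (char_prefix pi k.+1) p (set_label st p None).
Proof.
move=> p L; rewrite /labelled_but /set_label eqxx; split=> // i ip.
rewrite (negPf ip); have [lb sti fi] := L i; exists lb => //.
rewrite -(fits_eq (s := char_prefix pi k))// => j ji.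
rewrite !char_prefixE ltnS [RHS]leq_eqVlt.
suff -> : ((pi^-1)%g j == k :> nat) = false by [].
apply: contraNF ip => /eqP jk; rewrite -ji /p.
by rewrite -(permKV pi j); apply/eqP; congr (coordinate (pi _)); apply: val_inj.
Qed.

(** A bound on the calls still chargeable to an index, counting its later label moves and the calls
    that end its own drives. [Alpha0] has 3: reaching the lower bound, ending the upward drive or
    leaving [AlphaLow], and leaving [AlphaPlus]. *)
Definition weight (lb : label) : nat :=
  match lb with
  | Alpha0 => 3%N | AlphaLow => 2%N | AlphaPlus => 1%N | AlphaUp => 0%N
  | BetaMinus => 2%N | BetaOminus => 1%N | Beta0 => 1%N | BetaOplus => 1%N
  | BetaPlus => 0%N
  end.

Definition total_weight st : nat :=
  (\sum_i (if st i is Some lb then weight lb else 0%N))%N.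

Definition phase_weight (ph : phase R n1 n2) : nat :=
  match ph with
  | ToLower p y0 => if y0 < pad n2 l 0 p then 3%N else 2%N
  | Upward _ _ | ToZero _ _ => 2%N
  | Positive _ _ => 1%N
  | Idle _ | Settled => 0%N
  end.

Definition phase_rank (ph : phase R n1 n2) : nat :=
  match ph with
  | Idle _ => 3%N | ToLower _ _ => 2%N
  | Upward _ _ | ToZero _ _ | Positive _ _ => 1%N
  | Settled => 0%N
  end.

(* Bounds the number of calls to [pivot] still to come. *)
Definition budget (c : config R n1 n2) : nat :=
  (total_weight (sets c) + phase_weight (control c))%N.

(** Transitions without a call lower the rank inside a pass. The output raises it from 0 to 3, which
    the factor 4 on the remaining passes outweighs. *)
Definition run_measure (c : config R n1 n2) : nat :=
  (budget c + phase_rank (control c) + 4 * (n1 + n2 + n2 - Defs.iter c))%N.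

Lemma total_weight_set st p lb lb' : st p = lb ->
  (total_weight (set_label st p lb') + (if lb is Some b then weight b else 0%N)
   = total_weight st + (if lb' is Some b then weight b else 0%N))%N.
Proof.
move=> stp; rewrite /total_weight (bigD1 p)//= [in RHS](bigD1 p)//= stp.
rewrite {1}/set_label eqxx.
rewrite (eq_bigr (fun i => if st i is Some lb then weight lb else 0%N)).
  by lia.
by move=> i ip; rewrite /set_label (negPf ip).
Qed.

Lemma total_weight_moved st i : movable (st i) ->
  total_weight st = (total_weight (set_label st i (moved (st i)))).+1.
Proof.
move=> mi; have := @total_weight_set st i _ (moved (st i)) erefl.
by move: mi; case: (st i) => [[]|] //= _; lia.
Qed.

(* The consistent point [x] stands at the largest value reached by the driving
   coordinate; [y0] may have fallen back below it. *)
Definition phase_inv k (ph : phase R n1 n2) st : Prop :=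
  let driving p y0 (P : point -> Prop) :=
    [/\ (k < n1 + n2 + n2)%N, labelled_but (char_prefix pi k.+1) p st &
        exists x, [/\ consistent f a l u st x, y0 <= x 0 p & P x]] in
  let alpha p := forall lb, lb = AlphaLow \/ lb = AlphaPlus \/ lb = AlphaUp ->
    fits (char_prefix pi k.+1) p lb in
  match ph with
  | Idle x => labelled (char_prefix pi k) st /\ consistent f a l u st x
  | ToLower p y0 => alpha p /\ driving p y0 (fun x => x 0 p <= pad n2 l 0 p)
  | Upward p y0 => alpha p /\ driving p y0 (fun x =>
      pad n2 l 0 p <= x 0 p <= pad n2 u 0 p /\ partial f p x <= a 0 p)
  | ToZero p y0 => fits (char_prefix pi k.+1) p Beta0 /\
      driving p y0 (fun x => x 0 p <= 0)
  | Positive p y0 => fits (char_prefix pi k.+1) p BetaPlus /\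
      driving p y0 (fun x => 0 <= x 0 p /\ partial f p x <= a 0 p)
  | Settled => [/\ (k < n1 + n2 + n2)%N, labelled (char_prefix pi k.+1) st &
      exists x, consistent f a l u st x]
  end.

Definition config_inv (c : config R n1 n2) : Prop :=
  [/\ (Defs.iter c <= n1 + n2 + n2)%N,
      phase_inv (Defs.iter c) (control c) (sets c),
      size (outputs c) = (Defs.iter c).+1,
      forall k, (k <= Defs.iter c)%N ->
        is_value f a l u (char_prefix pi k) (nth 0 (outputs c) k) &
      (calls c + budget c <= 3 * (n1 + n2))%N].

Lemma set_label_set st p q q' :
  set_label (set_label st p q) p q' = set_label st p q'.
Proof. by apply/funext => i; rewrite /set_label; case: eqP. Qed.

Lemma char_prefix_at k (kN : (k < n1 + n2 + n2)%N) j : pi (Ordinal kN) = j ->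
  char_prefix pi k j = false /\ char_prefix pi k.+1 j = true.
Proof. by move=> <-; rewrite !char_prefixE permK /= ltnn ltnS leqnn. Qed.

Lemma char_prefix_before k (kN : (k < n1 + n2 + n2)%N) (j : 'I_n2) :
  pi (Ordinal kN) = lshift n2 (rshift n1 j) ->
  char_prefix pi k (rshift (n1 + n2) j) = false /\
  char_prefix pi k.+1 (rshift (n1 + n2) j) = false.
Proof.
move=> e; have := pi_compatible j; rewrite -e permK /= !char_prefixE => h.
by split; apply/negbTE; rewrite -leqNgt// ltnW.
Qed.

Lemma char_prefix_after k (kN : (k < n1 + n2 + n2)%N) (j : 'I_n2) :
  pi (Ordinal kN) = rshift (n1 + n2) j ->
  char_prefix pi k (lshift n2 (rshift n1 j)) = true /\
  char_prefix pi k.+1 (lshift n2 (rshift n1 j)) = true.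
Proof.
move=> e; have := pi_compatible j; rewrite -e permK /= !char_prefixE => h.
by rewrite h ltnS ltnW.
Qed.

(** * Preservation of the invariant by each transition *)

Local Notation "c ~> c'" :=
  (config_inv c' /\ (run_measure c' < run_measure c)%N) (at level 70).

Lemma inv_step c c' : config_inv c ->
  Defs.iter c' = Defs.iter c -> outputs c' = outputs c ->
  phase_inv (Defs.iter c) (control c') (sets c') ->
  (calls c' + budget c' <= calls c + budget c)%N ->
  (budget c' + phase_rank (control c') < budget c + phase_rank (control c))%N ->
  c ~> c'.
Proof.
move=> [h1 h2 h3 h4 h5] e1 e2 ph hb hr; rewrite /config_inv /run_measure e1 e2.
by split; [split=> //|]; move: h1 h5 hb hr; clear; lia.
Qed.

Lemma inv_start_i k (kN : (k < n1 + n2 + n2)%N) (j : 'I_n1) x st o m :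
  pi (Ordinal kN) = lshift n2 (lshift n2 j) ->
  let p := lshift n2 j in
  let c := Config k (Idle x) st o m in
  config_inv c ->
  c ~> Config k (ToLower p (x 0 p)) (set_label st p None) o m.
Proof.
move=> e p c I; have [/= _ [L cx] _ _ _] := I.
have [s0 s1] := char_prefix_at e.
have Lp := labelled_start kN L; rewrite /= e coordinate_lshift -/p in Lp.
have [lb stp] := L p; rewrite fits_lshift s0; case: lb stp => // stp _.
have xp : x 0 p = 0 by have := cx p; rewrite stp.
have := total_weight_set None stp; rewrite /= addn0 => tw.
apply: inv_step => //=; rewrite /budget /= ?addn0.
- split; first by move=> lb; rewrite fits_lshift s1 => -[->|[->|->]].
  split=> //; exists x; split=> //; first exact: consistent_set.
  (* The drive starts at 0, not above the lower bound because [l] is nonnegative. *)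
  by rewrite xp /pad row_mxEl.
- by case: ifP => _; move: tw; clear; lia.
- by case: ifP => _; move: tw; clear; lia.
Qed.

Lemma inv_to_lower_pivot k p (y0 y : R) st st' o m :
  let c := Config k (ToLower p y0) st o m in
  y0 < pad n2 l 0 p ->
  pivot f a l u st p y0 (pad n2 l 0 p) y st' ->
  config_inv c -> c ~> Config k (ToLower p y) st' o m.+1.
Proof.
move=> c y0l pv I; have [/= _ [al [kN Lp [x [cx yx xl]]]] _ _ _] := I.
have [x' [cx' _ /andP[xx' x'l] yx' alt]] :=
  pivot_spec df mu0 fconv fsub lu (labelled_but_driven Lp) cx xl pv.
apply: inv_step => //=; rewrite /budget /= ?y0l.
- split=> //; split=> //; last by exists x'.
  by case: alt => [[_ ->]//|[_ [i mi ->]]]; apply: labelled_but_moved.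
- case: alt => [[-> ->]|[yl [i mi ->]]]; first by rewrite ltxx; clear; lia.
  by rewrite yl (total_weight_moved mi); clear; lia.
- case: alt => [[-> ->]|[yl [i mi ->]]]; first by rewrite ltxx; clear; lia.
  by rewrite yl (total_weight_moved mi); clear; lia.
Qed.

(** The consistent point is at or beyond [y0] but not beyond the lower bound; once [y0] reaches the
    bound, the two coincide. *)
Lemma to_lower_end k p (y0 : R) st o m X :
  config_inv (Config k (ToLower p y0) st o m) -> pad n2 l 0 p <= y0 ->
  curve_of f a l u st p X ->
  consistent f a l u st (X (pad n2 l 0 p)).
Proof.
move=> [/= _ [al [kN Lp [x [cx yx xl]]]] _ _ _] ly cX.
have -> : pad n2 l 0 p = x 0 p by apply/eqP; rewrite eq_le xl (le_trans ly).
have pd := labelled_but_driven Lp.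
by rewrite (curve_of_point df mu0 fconv fsub pd cX (consistent_point cx)).
Qed.

Lemma inv_to_lower_stop k p (y0 : R) st X o m :
  let c := Config k (ToLower p y0) st o m in
  pad n2 l 0 p <= y0 ->
  curve_of f a l u st p X ->
  0 <= partial f p (X (pad n2 l 0 p)) - a 0 p ->
  config_inv c ->
  c ~> Config k (Settled R n1 n2) (set_label st p (Some AlphaLow)) o m.
Proof.
move=> c ly cX; rewrite subr_ge0 => hp I; have cXl := to_lower_end I ly cX.
have [/= _ [al [kN Lp _]] _ _ _] := I.
have := total_weight_set (Some AlphaLow) (proj1 Lp); rewrite /= addn0 => tw.
apply: inv_step => //=; rewrite /budget /= ?ltNge ?ly /=; try (move: tw; clear; lia).
split=> //; first by apply: labelled_set => //; apply: al; left.
exists (X (pad n2 l 0 p)); apply: consistent_set => //.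
by split=> //; have [] := cX (pad n2 l 0 p).
Qed.

Lemma inv_to_lower_continue k p (y0 : R) st X o m :
  let c := Config k (ToLower p y0) st o m in
  pad n2 l 0 p <= y0 ->
  curve_of f a l u st p X ->
  partial f p (X (pad n2 l 0 p)) - a 0 p < 0 ->
  config_inv c -> c ~> Config k (Upward p y0) st o m.
Proof.
move=> c ly cX; rewrite subr_lt0 => hp I; have cXl := to_lower_end I ly cX.
have [/= _ [al [kN Lp [x [cx yx xl]]]] _ _ _] := I.
have [Xl _] := cX (pad n2 l 0 p).
apply: inv_step => //=; rewrite /budget /= ?ltNge ?ly /=; try (clear; lia).
split=> //; split=> //; exists (X (pad n2 l 0 p)); rewrite Xl; split=> //.
  exact: le_trans yx xl.
by rewrite lexx pad_le//; split=> //; exact: ltW.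
Qed.


(** The driven partial derivative is strictly increasing along the curve, so its comparison with
    [a 0 p] tells on which side of the root a point lies. *)
Lemma driven_root_ge st p x X (y : R) : driven st p ->
  curve_of f a l u st p X -> point_of f a l u st x ->
  partial f p (X y) = a 0 p -> (partial f p x <= a 0 p) = (x 0 p <= y).
Proof.
move=> pd cX px hy; have /(curve_of_solution f a l u X pd) sX := cX.
rewrite -(curve_of_point df mu0 fconv fsub pd cX px) -hy.
have [-> _] := cX (x 0 p); apply/idP/idP => [|xy]; last first.
  exact: (curve_partial_driven_le df mu0 fconv sX).
apply: contraTT; rewrite -!ltNge.
exact: (curve_partial_driven_lt df mu0 fconv sX).
Qed.

Lemma inv_upward_pivot k p (y0 y : R) st st' X (yroot : R) o m :
  let c := Config k (Upward p y0) st o m in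
  curve_of f a l u st p X ->
  partial f p (X yroot) - a 0 p = 0 ->
  let ybar := Num.min yroot (pad n2 u 0 p) in
  pivot f a l u st p y0 ybar y st' ->
  config_inv c ->
  c ~> (if y == ybar
        then Config k (Settled R n1 n2)
               (set_label st' p
                  (Some (if ybar < pad n2 u 0 p then AlphaPlus else AlphaUp)))
               o m.+1
        else Config k (Upward p y) st' o m.+1).
Proof.
move=> c cX /eqP; rewrite subr_eq0 => /eqP hroot ybar pv I.
have [/= _ [al [kN Lp [x [cx yx [/andP[lx xu] px]]]]] _ _ _] := I.
have pd := labelled_but_driven Lp.
have root_ge z := @driven_root_ge st p z X yroot pd cX.
have xroot : x 0 p <= yroot.
  by rewrite -(root_ge x)//; apply: consistent_point.
have xy : x 0 p <= ybar by rewrite le_min xroot.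
have [x' [cx' px' /andP[xx' x'y] yx' alt]] :=
  pivot_spec df mu0 fconv fsub lu pd cx xy pv.
have x'u : x' 0 p <= pad n2 u 0 p by rewrite (le_trans x'y)// ge_min lexx orbT.
have x'root : x' 0 p <= yroot by rewrite (le_trans x'y)// ge_min lexx.
have dx' : partial f p x' <= a 0 p by rewrite (root_ge x').
have lx' := le_trans lx xx'.
case: alt => [[yE ->]|[ylt [i mi st'E]]]; last first.
  rewrite (lt_eqF ylt); apply: inv_step => //=; rewrite /budget /=.
  - split=> //; split=> //; first by rewrite st'E; apply: labelled_but_moved.
    by exists x'; split=> //; rewrite lx' x'u.
  - by rewrite (total_weight_moved mi) -st'E; clear; lia.
  - by rewrite (total_weight_moved mi) -st'E; clear; lia.
(* The call that ends the loop: the consistent point has caught up with [ybar]. *)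
have x'E : x' 0 p = ybar by apply/eqP; rewrite eq_le x'y -yE.
have stE : st' = st.
  by case: pv => X1 [r [i1 [_ _ _ _ ->]]]; rewrite yE ltxx.
rewrite yE eqxx; set lb := (if _ then _ else _).
have lb_al : lb = AlphaLow \/ lb = AlphaPlus \/ lb = AlphaUp.
  by rewrite /lb; case: ifP; auto.
have wlb : (weight lb <= 1)%N by rewrite /lb; case: ifP.
have := total_weight_set (Some lb) (proj1 Lp); rewrite /= addn0 => tw.
apply: inv_step => //=; rewrite /budget /=; try (move: tw wlb; clear; lia).
split=> //; first by apply: labelled_set => //; apply: al.
rewrite stE in cx'; exists x'; apply: consistent_set => //.
(* At the upper bound, the inequality [dx'] is the condition of [AlphaUp]; below it, [ybar] is the
   root itself and the derivative condition is an equality. *)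
rewrite /lb; case: ifPn => [ylu|]; last first.
  by rewrite -leNgt -x'E => ux'; split=> //; apply/eqP; rewrite eq_le x'u.
split; last by rewrite lx'.
have -> : x' = X yroot.
  have <- := curve_of_point df mu0 fconv fsub pd cX px'.
  rewrite x'E; congr X; move: ylu; rewrite /ybar minElt; case: ifP => //.
  by rewrite ltxx.
exact: hroot.
Qed.

Lemma inv_start_ii_zero k (kN : (k < n1 + n2 + n2)%N) (j : 'I_n2) x st o m :
  pi (Ordinal kN) = lshift n2 (rshift n1 j) ->
  let p := rshift n1 j in
  let c := Config k (Idle x) st o m in
  x 0 p = 0 -> config_inv c ->
  c ~> Config k (Settled R n1 n2) (set_label st p (Some Beta0)) o m.
Proof.
move=> e p c xp I; have [/= _ [L cx] _ _ _] := I.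
have [s0 s1] := char_prefix_at e.
have [s2 s3] := char_prefix_before e.
have Lp := labelled_start kN L; rewrite /= e coordinate_lshift -/p in Lp.
have [lb stp flb] := L p.
(* The old label is [BetaMinus] or [BetaOminus], each at least as heavy as [Beta0]. *)
have wlb : (1 <= weight lb)%N.
  by move: flb; rewrite fits_rshift s0 s2; case: lb {stp}.
have := total_weight_set (Some Beta0) stp; rewrite /= => tw.
apply: inv_step => //=; rewrite /budget /=; try (move: tw wlb; clear; lia).
split=> //; last by exists x; apply: consistent_set.
rewrite -(set_label_set st p None); apply: labelled_set => //.
by rewrite fits_rshift s1 s3.
Qed.

Lemma inv_start_ii_nonzero k (kN : (k < n1 + n2 + n2)%N) (j : 'I_n2) x st o m :
  pi (Ordinal kN) = lshift n2 (rshift n1 j) ->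
  let p := rshift n1 j in
  let c := Config k (Idle x) st o m in
  x 0 p <> 0 -> config_inv c ->
  c ~> Config k (ToZero p (x 0 p)) (set_label st p None) o m.
Proof.
move=> e p c xp I; have [/= _ [L cx] _ _ _] := I.
have [s0 s1] := char_prefix_at e.
have [s2 s3] := char_prefix_before e.
have Lp := labelled_start kN L; rewrite /= e coordinate_lshift -/p in Lp.
have [lb stp] := L p; rewrite fits_rshift s0 s2.
(* A nonzero coordinate excludes [BetaOminus], so the label is [BetaMinus] and the drive starts from
   a nonpositive value. *)
have := cx p; rewrite stp; case: lb stp => // stp; last by case=> /xp.
move=> [_ xp0] _.
have := total_weight_set None stp; rewrite /= => tw.
apply: inv_step => //=; rewrite /budget /=; try (move: tw; clear; lia).
split; first by rewrite fits_rshift s1 s3.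
by split=> //; exists x; split=> //; apply: consistent_set.
Qed.

Lemma inv_to_zero_pivot k p (y0 y : R) st st' o m :
  let c := Config k (ToZero p y0) st o m in
  pivot f a l u st p y0 0 y st' -> config_inv c ->
  c ~> (if y == 0
        then Config k (Settled R n1 n2) (set_label st' p (Some Beta0)) o m.+1
        else Config k (ToZero p y) st' o m.+1).
Proof.
move=> c pv I; have [/= _ [fp [kN Lp [x [cx yx x0]]]] _ _ _] := I.
have [x' [cx' _ /andP[xx' x'0] yx' alt]] :=
  pivot_spec df mu0 fconv fsub lu (labelled_but_driven Lp) cx x0 pv.
case: alt => [[yE stE]|[ylt [i mi st'E]]]; last first.
  rewrite (lt_eqF ylt); apply: inv_step => //=; rewrite /budget /=.
  - split=> //; split=> //; first by rewrite st'E; apply: labelled_but_moved.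
    by exists x'.
  - by rewrite (total_weight_moved mi) -st'E; clear; lia.
  - by rewrite (total_weight_moved mi) -st'E; clear; lia.
rewrite stE in cx' *; rewrite yE eqxx.
have := total_weight_set (Some Beta0) (proj1 Lp); rewrite /= addn0 => tw.
apply: inv_step => //=; rewrite /budget /=; try (move: tw; clear; lia).
split=> //; first exact: labelled_set.
exists x'; apply: consistent_set => //=.
by apply/eqP; rewrite eq_le x'0 -yE.
Qed.

(** Compatibility has placed the first item of the coordinate in the prefix already, while the
    second is only now entering; [Beta0] is the one label that fits. *)
Lemma labelled_beta0 k (kN : (k < n1 + n2 + n2)%N) (j : 'I_n2) st :
  pi (Ordinal kN) = rshift (n1 + n2) j ->
  labelled (char_prefix pi k) st ->
  [/\ st (rshift n1 j) = Some Beta0,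
      labelled_but (char_prefix pi k.+1) (rshift n1 j)
        (set_label st (rshift n1 j) None),
      fits (char_prefix pi k.+1) (rshift n1 j) BetaOplus &
      fits (char_prefix pi k.+1) (rshift n1 j) BetaPlus].
Proof.
move=> e L.
have [s0 s1] := char_prefix_at e.
have [s2 s3] := char_prefix_after e.
have Lp := labelled_start kN L; rewrite /= e coordinate_rshift in Lp.
have [lb stp] := L (rshift n1 j); rewrite fits_rshift s0 s2.
case: lb stp => // stp _; split=> //; by rewrite fits_rshift s1 s3.
Qed.

Lemma inv_start_iii_stop k (kN : (k < n1 + n2 + n2)%N) (j : 'I_n2) x st X o m :
  pi (Ordinal kN) = rshift (n1 + n2) j ->
  let p := rshift n1 j in
  let c := Config k (Idle x) st o m in
  curve_of f a l u (set_label st p None) p X ->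
  0 <= partial f p (X 0) - a 0 p -> config_inv c ->
  c ~> Config k (Settled R n1 n2) (set_label st p (Some BetaOplus)) o m.
Proof.
move=> e p c cX; rewrite subr_ge0 => hp I; have [/= _ [L cx] _ _ _] := I.
have [stp Lp fo _] := labelled_beta0 e L; rewrite -/p in stp Lp fo.
have xp : x 0 p = 0 by have := cx p; rewrite stp.
have cx' : consistent f a l u (set_label st p None) x by apply: consistent_set.
have := curve_of_point df mu0 fconv fsub (labelled_but_driven Lp) cX
  (consistent_point cx').
rewrite xp => Xx; rewrite Xx in hp.
have := total_weight_set (Some BetaOplus) stp; rewrite /= => tw.
apply: inv_step => //=; rewrite /budget /=; try (move: tw; clear; lia).
split=> //; last by exists x; apply: consistent_set.
by rewrite -(set_label_set st p None); apply: labelled_set.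
Qed.

Lemma inv_start_iii_continue k (kN : (k < n1 + n2 + n2)%N) (j : 'I_n2)
    x st X o m :
  pi (Ordinal kN) = rshift (n1 + n2) j ->
  let p := rshift n1 j in
  let c := Config k (Idle x) st o m in
  curve_of f a l u (set_label st p None) p X ->
  partial f p (X 0) - a 0 p < 0 -> config_inv c ->
  c ~> Config k (Positive p (x 0 p)) (set_label st p None) o m.
Proof.
move=> e p c cX; rewrite subr_lt0 => hp I; have [/= _ [L cx] _ _ _] := I.
have [stp Lp _ fp] := labelled_beta0 e L; rewrite -/p in stp Lp fp.
have xp : x 0 p = 0 by have := cx p; rewrite stp.
have cx' : consistent f a l u (set_label st p None) x by apply: consistent_set.
have := curve_of_point df mu0 fconv fsub (labelled_but_driven Lp) cX
  (consistent_point cx').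
rewrite xp => Xx; rewrite Xx in hp.
have := total_weight_set None stp; rewrite /= => tw.
apply: inv_step => //=; rewrite /budget /=; try (move: tw; clear; lia).
split=> //; split=> //; exists x; rewrite xp lexx; split=> //.
by split=> //; apply: ltW.
Qed.

Lemma inv_positive_pivot k p (y0 y : R) st st' X (ybar : R) o m :
  let c := Config k (Positive p y0) st o m in
  curve_of f a l u st p X ->
  partial f p (X ybar) - a 0 p = 0 ->
  pivot f a l u st p y0 ybar y st' -> config_inv c ->
  c ~> (if y == ybar
        then Config k (Settled R n1 n2) (set_label st' p (Some BetaPlus)) o m.+1
        else Config k (Positive p y) st' o m.+1).
Proof.
move=> c cX /eqP; rewrite subr_eq0 => /eqP hroot pv I.
have [/= _ [fp [kN Lp [x [cx yx [x0 px]]]]] _ _ _] := I.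
have pd := labelled_but_driven Lp.
have root_ge z := @driven_root_ge st p z X ybar pd cX.
have xy : x 0 p <= ybar.
  by rewrite -(root_ge x)//; apply: consistent_point.
have [x' [cx' px' /andP[xx' x'y] yx' alt]] :=
  pivot_spec df mu0 fconv fsub lu pd cx xy pv.
have dx' : partial f p x' <= a 0 p by rewrite (root_ge x').
have x'0 := le_trans x0 xx'.
case: alt => [[yE stE]|[ylt [i mi st'E]]]; last first.
  rewrite (lt_eqF ylt); apply: inv_step => //=; rewrite /budget /=.
  - split=> //; split=> //; first by rewrite st'E; apply: labelled_but_moved.
    by exists x'.
  - by rewrite (total_weight_moved mi) -st'E; clear; lia.
  - by rewrite (total_weight_moved mi) -st'E; clear; lia.
have x'E : x' 0 p = ybar by apply/eqP; rewrite eq_le x'y -yE.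
rewrite stE in cx' *; rewrite yE eqxx.
have := total_weight_set (Some BetaPlus) (proj1 Lp); rewrite /= addn0 => tw.
apply: inv_step => //=; rewrite /budget /=; try (move: tw; clear; lia).
split=> //; first exact: labelled_set.
exists x'; apply: consistent_set => //=; split=> //.
by rewrite -(curve_of_point df mu0 fconv fsub pd cX px') x'E.
Qed.

Lemma inv_output k st x o m :
  let c := Config k (Settled R n1 n2) st o m in
  point_of f a l u st x -> config_inv c ->
  c ~> Config k.+1 (Idle x) st (rcons o (objective f a x)) m.
Proof.
move=> c px [/= _ [kN L [x' cx]] so val hm].
(* The output point is determined by the labels, hence it is the consistent one and its value is
   optimal. *)
have xx' : x = x'.
  apply: (point_of_unique df mu0 fconv fsub _ px (consistent_point cx)) => i.
  exact: labelled_some L.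
rewrite -xx' in cx; split; last first.
  by rewrite /run_measure /budget /=; move: kN; clear; lia.
split=> //=; first by rewrite size_rcons so.
move=> i; rewrite nth_rcons so leq_eqVlt => /orP[/eqP ->|ik].
  by rewrite ltnn eqxx; apply: consistent_optimal L cx.
by rewrite ik; apply: val.
Qed.

(** * Progress and termination of every run *)

Lemma inv_preserved c c' : config_inv c -> step f a l u pi c c' -> c ~> c'.
Proof.
move=> + cc'; case: cc'.
- by move=> k kN j x st o m e p; apply: inv_start_i.
- by move=> k p y0 y st st' o m y0l pv; apply: inv_to_lower_pivot pv.
- by move=> k p y0 st X o m ly cX hp; apply: inv_to_lower_stop cX hp.
- by move=> k p y0 st X o m ly cX hp; apply: inv_to_lower_continue cX hp.
- by move=> k p y0 y st st' X yroot o m cX hp ybar pv; apply: inv_upward_pivot hp pv.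
- by move=> k kN j x st o m e p xp; apply: inv_start_ii_zero xp.
- by move=> k kN j x st o m e p xp; apply: inv_start_ii_nonzero xp.
- by move=> k p y0 y st st' o m pv; apply: inv_to_zero_pivot pv.
- by move=> k kN j x st X o m e p cX hp; apply: inv_start_iii_stop cX hp.
- by move=> k kN j x st X o m e p cX hp; apply: inv_start_iii_continue cX hp.
- by move=> k p y0 y st st' X ybar o m cX hp pv; apply: inv_positive_pivot hp pv.
- by move=> k st x o m px; apply: inv_output px.
Qed.

(** No control point is stuck before completion: the tests in each phase are exhaustive, and the
    curves, driven roots, calls and output points they require all exist. *)
Lemma inv_progress c : config_inv c ->
  completed c \/ exists c', step f a l u pi c c'.
Proof.
case: c => k ph st o m [/= kT + _ _ _].
have root p X : driven st p -> curve_of f a l u st p X ->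
    exists y, partial f p (X y) - a 0 p = 0.
  move=> pd /(curve_of_solution f a l u X pd) sX.
  have [y hy] := curve_partial_driven_root df mu0 fconv fsub sX.
  by exists y; rewrite hy subrr.
case: ph => /= [x [L cx]|p y0 [_ [_ Lp _]]|p y0 [_ [_ Lp _]]|p y0 [_ [_ Lp _]]
               |p y0 [_ [_ Lp _]]|[_ L _]].
- move: kT; rewrite leq_eqVlt => /orP[/eqP kT|kN].
    by left; split=> //; exists x.
  right; have := splitK (pi (Ordinal kN)).
  case: (fintype.split _) => [i|j] /= e.
    have := splitK i; case: (fintype.split i) => j /= ij; rewrite -ij in e.
      by eexists; apply: start_i (esym e).
    have [x0|x0] := eqVneq (x 0 (rshift n1 j)) 0.
      by eexists; apply: start_ii_zero (esym e) x0.
    by eexists; apply: start_ii_nonzero (esym e) _; apply/eqP.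
  have [_ Lp _ _] := labelled_beta0 (esym e) L.
  have [X cX] := curve_of_exists a l u df mu0 fconv (labelled_but_driven Lp).
  case: (leP 0 (partial f (rshift n1 j) (X 0) - a 0 (rshift n1 j))) => h.
    by eexists; apply: start_iii_stop (esym e) cX h.
  by eexists; apply: start_iii_continue (esym e) cX h.
- right; have pd := labelled_but_driven Lp.
  case: (ltP y0 (pad n2 l 0 p)) => y0l.
    have [y [st' pv]] := pivot_exists a l u df mu0 fconv y0 (pad n2 l 0 p) pd.
    by eexists; apply: to_lower_pivot pv.
  have [X cX] := curve_of_exists a l u df mu0 fconv pd.
  case: (leP 0 (partial f p (X (pad n2 l 0 p)) - a 0 p)) => h.
    by eexists; apply: to_lower_stop cX h.
  by eexists; apply: to_lower_continue cX h.
- right; have pd := labelled_but_driven Lp.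
  have [X cX] := curve_of_exists a l u df mu0 fconv pd.
  have [yroot hy] := root p X pd cX.
  have [y [st' pv]] := pivot_exists a l u df mu0 fconv y0
    (Num.min yroot (pad n2 u 0 p)) pd.
  by eexists; apply: upward_pivot cX hy pv.
- right; have pd := labelled_but_driven Lp.
  have [y [st' pv]] := pivot_exists a l u df mu0 fconv y0 0 pd.
  by eexists; apply: to_zero_pivot pv.
- right; have pd := labelled_but_driven Lp.
  have [X cX] := curve_of_exists a l u df mu0 fconv pd.
  have [ybar hy] := root p X pd cX.
  have [y [st' pv]] := pivot_exists a l u df mu0 fconv y0 ybar pd.
  by eexists; apply: positive_pivot cX hy pv.
- right; have [x px] := point_of_exists a l u df mu0 fconv
    (fun i => labelled_some L (i := i)).
  by eexists; apply: output px.
Qed.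

Lemma inv_run c : config_inv c ->
  every_run_ends_in (step f a l u pi) (fun c => completed c /\ config_inv c) c.
Proof.
have [n] := ubnP (run_measure c); elim: n c => // n IHn c; rewrite ltnS => cn I.
have [ex|nex] := pselect (exists c', step f a l u pi c c').
  apply: run_goes_on => // c' /(inv_preserved I)[I' c'c].
  by apply: IHn => //; apply: leq_trans c'c cn.
apply: run_halts; first by move=> c' cc'; apply: nex; exists c'.
by split=> //; case: (inv_progress I).
Qed.

(** * The initial configuration *)

Lemma initial_exists : exists c, initial f a c.
Proof.
pose I i : set R := if fintype.split i then [set 0]%classic else
  [set y | y <= 0]%classic.
have [||x xI xmin] := @exists_box_minimizer R _ f a mu df mu0 fconv I 0.
- move=> i; rewrite /I; case: (fintype.split i) => ?; first exact: closed_eq.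
  exact: closed_le.
- by move=> i; rewrite /I mxE; case: (fintype.split i) => ? /=.
have IE z : (forall i, I i (z 0 i)) <->
    (forall i : 'I_n1, z 0 (lshift n2 i) = 0) /\
    (forall i : 'I_n2, z 0 (rshift n1 i) <= 0).
  split=> [zI|[za zb] i].
    split=> i; first by have := zI (lshift n2 i); rewrite /I (unsplitK (inl i)).
    by have := zI (rshift n1 i); rewrite /I (unsplitK (inr i)).
  by rewrite -(splitK i) /I unsplitK; case: (fintype.split i) => j /=.
eexists; exists x; split; last reflexivity; first exact/IE.
by move=> z /IE; apply: xmin.
Qed.

Lemma initial_inv c : initial f a c -> config_inv c.
Proof.
move=> [x [[xa xb] xmin ->]].
set st := (X in Config _ _ X).
have sta j : st (lshift n2 j) = Some Alpha0.
  by rewrite /st (unsplitK (inl j)).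
have stb j : st (rshift n1 j) =
    Some (if x 0 (rshift n1 j) < 0 then BetaMinus else BetaOminus).
  by rewrite /st (unsplitK (inr j)).
have L : labelled (char_prefix pi 0) st.
  move=> i; rewrite -(splitK i); case: (fintype.split i) => j /=.
    by exists Alpha0; rewrite ?sta// fits_lshift char_prefixE.
  rewrite stb; eexists; first reflexivity.
  by rewrite fits_rshift !char_prefixE; case: ifP.
(* Feasible moves of one beta coordinate: downwards always, giving one inequality on the derivative,
   and upwards as far as 0, giving the other when the coordinate is negative. *)
have shift (t : R) j : x 0 (rshift n1 j) + t <= 0 ->
    (forall i : 'I_n1, (x + t *: delta_mx 0 (rshift n1 j)) 0 (lshift n2 i) = 0) /\
    (forall i : 'I_n2, (x + t *: delta_mx 0 (rshift n1 j)) 0 (rshift n1 i) <= 0).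
  move=> xt; split=> i; rewrite !mxE eqxx /=.
    by rewrite eq_lrshift mulr0 addr0.
  rewrite eq_rshift; case: eqP => [->|_]; first by rewrite mulr1.
  by rewrite mulr0 addr0.
have cx : consistent f a l u st x.
  move=> i; rewrite -(splitK i); case: (fintype.split i) => j /=.
    by rewrite sta /=.
  have ple : partial f (rshift n1 j) x <= a 0 (rshift n1 j).
    apply: (minimizer_partial_le df ltr01 (i := rshift n1 j) xmin) => t /andP[t0 _].
    rewrite -scaleNr; apply: shift.
    by have := xb j; lra.
  rewrite stb; case: ifPn => [xj|]; last first.
    by rewrite -leNgt => xj; split=> //; apply/eqP; rewrite eq_le xb.
  split; last exact: xb.
  apply/eqP; rewrite eq_le ple.
  have xj' : 0 < - x 0 (rshift n1 j) by rewrite oppr_gt0.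
  apply: (minimizer_partial_ge df xj' (i := rshift n1 j) xmin) => t /andP[_ t1].
  by apply: shift; lra.
split=> //=.
- by case=> // _; apply: consistent_optimal L cx.
(* No call has been made yet, and every label weighs at most 3. *)
- rewrite add0n /budget /= addn0 /total_weight.
  rewrite -[X in (_ <= 3 * X)%N]card_ord mulnC -sum_nat_const.
  by apply: leq_sum => i _; case: (st i) => // -[].
Qed.

End Run.

Theorem proposition4 :
  exists C : nat,
  forall (R : realType) (n1 n2 : nat) (f : 'rV[R]_(n1 + n2) -> R)
    (a : 'rV[R]_(n1 + n2)) (l u : 'rV[R]_n1) (pi : {perm 'I_(n1 + n2 + n2)}),
    (forall x, differentiable f x) ->
    strongly_convex f ->
    submodular f ->
    (forall i, 0 <= l 0 i) ->
    (forall i, l 0 i <= u 0 i) ->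
    compatible pi ->
    (exists c0, initial f a c0) /\
    forall c0, initial f a c0 ->
      every_run_ends_in (step f a l u pi)
        (fun c =>
           [/\ completed c,
               size (outputs c) = (n1 + n2 + n2).+1,
               forall k : nat, (k <= n1 + n2 + n2)%N ->
                 is_value f a l u (char_prefix pi k) (nth 0 (outputs c) k) &
               (calls c <= C * (n1 + n2))%N])
        c0.
Proof.
exists 3%N => R n1 n2 f a l u pi df [mu mu0 fconv] fsub l0 lu pi_compatible.
split=> [|c0 /(initial_inv pi df mu0 fconv lu) I]; first exact: (initial_exists a df mu0 fconv).
have := inv_run df mu0 fconv fsub l0 lu pi_compatible I.
(* Induction on the run only weakens the final property: at a stop, the remaining budget is dropped
   from the bound on [calls]. *)
elim=> {I c0} c.
  move=> halt [[cT ex] [/= _ _ so val hm]]; apply: run_halts => //.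
  rewrite cT in so val; split=> //.
  exact: leq_trans (leq_addr _ _) hm.
by move=> ex _ IH; apply: run_goes_on.
Qed.
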